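(* Let $H=(\mathcal{V},\mathcal{E})$ be a hypergraph with $m$ hyperedges, and for each positive integer $k$ let $G_k(H)$ be the conflict graph of $H$. Let $k_{min}$ be the smallest positive integer $k$ for which the independence number of $G_k(H)$ equals $m$. Then $\chi_{cf}(H)=k_{min}$. Further, $G_k(H)$ can be constructed in polynomial time, and thus the conflict-free colouring problem on hypergraphs can be reduced in polynomial time to the maximum independent set problem in conflict graphs.
   Context: A hypergraph $H=(\mathcal{V},\mathcal{E})$ has a finite vertex set $\mathcal{V}$ and a family $\mathcal{E}$ of nonempty subsets of $\mathcal{V}$ (hyperedges); $n=|\mathcal{V}|$, $m=|\mathcal{E}|$. A function $C:\mathcal{V}\to\{0,1,\dots,k\}$ is a conflict-free (CF) colouring of $H$ with $k$ non-zero colours if for every $e\in\mathcal{E}$ there is a non-zero colour $j\in\{1,\dots,k\}$ with $|e\cap C^{-1}(j)|=1$. $\chi_{cf}(H)$ is the minimum $k$ for which such a colouring exists. The conflict graph $G_k(H)$ is the simple graph whose nodes are the triples $(e,v,c)$ with $e\in\mathcal{E}$, $v\in e$, $1\le c\le k$, and whose edge set is $E_{vertex}\cup E_{edge}\cup E_{colour}$, where: $E_{vertex}$ consists of all pairs of nodes $(e,v,c),(g,v,d)$ with the same vertex coordinate $v$ and $c\neq d$; $E_{edge}$ consists of all pairs of distinct nodes $(e,v,c),(e,u,d)$ with the same hyperedge coordinate $e$; $E_{colour}$ consists of all pairs of nodes $(e,v,c),(g,u,c)$ with the same colour $c$, $u\neq v$, and $\{u,v\}\subseteq e$ or $\{u,v\}\subseteq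 g$. The independence number $\alpha(G)$ is the size of a maximum independent set of $G$. *)

(* Defs.v *)
(* MathComp. *)
From mathcomp Require Import all_boot ssralg poly.

Set Implicit Arguments.
Unset Strict Implicit.
Unset Printing Implicit Defensive.

Record hypergraph := Hypergraph {
  hvertex :> finType;
  hedges : {set {set hvertex}};
  hedges_neq0 : set0 \notin hedges
}.

Record sgraph := SGraph {
  snode :> finType;
  sadj : rel snode;
  sadj_sym : symmetric sadj;
  sadj_irrefl : irreflexive sadj
}.

Definition independent (G : sgraph) (S : {set G}) : bool :=
  [forall x in S, forall y in S, ~~ sadj x y].

Definition alpha (G : sgraph) : nat :=
  \max_(S : {set G} | independent S) #|S|.

Definition maximum_independent (G : sgraph) (S : {set G}) : bool :=
  independent S && (#|S| == alpha G).

Definition cf_colouring (H : hypergraph) (k : nat) (C : {ffun H -> 'I_k.+1}) :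
    bool :=
  [forall e in hedges H, exists j : 'I_k.+1,
     (0 < j) && (#|e :&: [set v | C v == j]| == 1)].

Definition cf_colourable (H : hypergraph) (k : nat) : bool :=
  [exists C : {ffun H -> 'I_k.+1}, cf_colouring C].

Lemma cf_colourable_ex (H : hypergraph) :
  exists k, (0 < k) && cf_colourable H k.
Proof.
exists #|H|.+1; apply/existsP.
exists [ffun v : H => inord (enum_rank v).+1]; apply/'forall_implyP => e eH.
have [v ve] : exists v, v \in e.
  by apply/set0Pn; apply: contraNneq (hedges_neq0 H) => <-.
have valC (u : H) :
    (inord (enum_rank u).+1 : 'I_#|H|.+2) = (enum_rank u).+1 :> nat.
  by rewrite inordK // !ltnS ltnW.
apply/existsP; exists (inord (enum_rank v).+1).
rewrite valC /=; apply/cards1P; exists v.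
apply/setP=> u; rewrite !inE ffunE -val_eqE /= !valC eqSS.
rewrite (inj_eq val_inj) (inj_eq enum_rank_inj).
by case: (u =P v) => [->|_]; rewrite ?ve ?andbF.
Qed.

(* The number of colours is a positive integer.  Allowing k = 0 would only
   change the value for the hypergraphs without hyperedges (from 1 to 0),
   since an actual hyperedge needs a non-zero colour. *)
Definition chi_cf (H : hypergraph) : nat := ex_minn (cf_colourable_ex H).

(* The node (e, v, c) is stored as ((e, v), c); colours stay numbered 1..k. *)
Definition conflict_node (H : hypergraph) (k : nat) : finType :=
  {x : {set H} * H * 'I_k.+1 |
     [&& x.1.1 \in hedges H, x.1.2 \in x.1.1 & 0 < x.2]}.

Section ConflictGraph.
Variables (H : hypergraph) (k : nat).
Implicit Types x y : conflict_node H k.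

Definition node_edge x : {set H} := (val x).1.1.
Definition node_vertex x : H := (val x).1.2.
Definition node_colour x : 'I_k.+1 := (val x).2.

Definition E_vertex x y : bool :=
  (node_vertex x == node_vertex y) && (node_colour x != node_colour y).

Definition E_edge x y : bool := (node_edge x == node_edge y) && (x != y).

Definition E_colour x y : bool :=
  [&& node_colour x == node_colour y, node_vertex x != node_vertex y &
      ([set node_vertex x; node_vertex y] \subset node_edge x)
   || ([set node_vertex x; node_vertex y] \subset node_edge y)].

Definition conflict_adj x y : bool :=
  [|| E_vertex x y, E_edge x y | E_colour x y].

Lemma conflict_adj_sym : symmetric conflict_adj.
Proof.
move=> x y; rewrite /conflict_adj /E_vertex /E_edge /E_colour.
rewrite [node_vertex y == _]eq_sym [node_colour y == _]eq_sym.
rewrite [node_edge y == _]eq_sym [y == x]eq_sym.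
by rewrite [[set node_vertex y; _]]setUC [(_ \subset node_edge y) || _]orbC.
Qed.

Lemma conflict_adj_irrefl : irreflexive conflict_adj.
Proof.
by move=> x; rewrite /conflict_adj /E_vertex /E_edge /E_colour !eqxx !andbF.
Qed.

Definition conflict_graph : sgraph :=
  SGraph conflict_adj_sym conflict_adj_irrefl.

End ConflictGraph.

Definition is_kmin (H : hypergraph) (k : nat) : Prop :=
  [/\ 0 < k, alpha (conflict_graph H k) = #|hedges H|
    & forall j, 0 < j -> alpha (conflict_graph H j) = #|hedges H| -> k <= j].

(* Model of computation: Jones' WHILE language over binary trees, extended
   with oracle queries.  An assignment is charged the size of the tree it
   writes, so that a program cannot build, by sharing subtrees, a tree larger
   than its running time (up to the input size and a constant factor that
   depends on the program); this cost is polynomially related to the number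
   of steps of a Turing machine. *)
Inductive tree := Nil | Cons of tree & tree.

Fixpoint tree_size (d : tree) : nat :=
  if d is Cons l r then (tree_size l + tree_size r).+1 else 1.

Definition tree_hd (d : tree) : tree := if d is Cons l _ then l else Nil.
Definition tree_tl (d : tree) : tree := if d is Cons _ r then r else Nil.
Definition is_cons (d : tree) : bool := if d is Cons _ _ then true else false.

Inductive expr :=
  | EVar of nat
  | ENil
  | ECons of expr & expr
  | EHd of expr
  | ETl of expr.

Definition store := nat -> tree.

Definition update (s : store) (x : nat) (d : tree) : store :=
  fun y => if y == x then d else s y.

Fixpoint eval (s : store) (a : expr) : tree :=
  match a with
  | EVar x => s x
  | ENil => Nil
  | ECons a1 a2 => Cons (eval s a1) (eval s a2)
  | EHd a1 => tree_hd (eval s a1)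
  | ETl a1 => tree_tl (eval s a1)
  end.

Inductive command :=
  | Skip
  | Assign of nat & expr
  | Seq of command & command
  | If of expr & command & command
  | While of expr & command
  | Query of nat & expr.

(* A query outside the domain of the oracle blocks the program. *)
Definition oracle := tree -> option tree.
Definition no_oracle : oracle := fun=> None.

(* [run O c s s' t]: started in the store s, the command c halts in the store
   s' after time t. *)
Inductive run (O : oracle) : command -> store -> store -> nat -> Prop :=
  | RunSkip s : run O Skip s s 1
  | RunAssign x a s :
      run O (Assign x a) s (update s x (eval s a)) (tree_size (eval s a)).+1
  | RunSeq c1 c2 s1 s2 s3 t1 t2 :
      run O c1 s1 s2 t1 -> run O c2 s2 s3 t2 ->
      run O (Seq c1 c2) s1 s3 (t1 + t2)
  | RunIfTrue a c1 c2 s s' t :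
      is_cons (eval s a) -> run O c1 s s' t -> run O (If a c1 c2) s s' t.+1
  | RunIfFalse a c1 c2 s s' t :
      ~~ is_cons (eval s a) -> run O c2 s s' t -> run O (If a c1 c2) s s' t.+1
  | RunWhileTrue a c s1 s2 s3 t1 t2 :
      is_cons (eval s1 a) -> run O c s1 s2 t1 ->
      run O (While a c) s2 s3 t2 -> run O (While a c) s1 s3 (t1 + t2).+1
  | RunWhileFalse a c s : ~~ is_cons (eval s a) -> run O (While a c) s s 1
  | RunQuery x a s d :
      O (eval s a) = Some d ->
      run O (Query x a) s (update s x d)
        (tree_size (eval s a) + tree_size d).+1.

(* Input and output are passed in variable 0. *)
Definition computes (O : oracle) (c : command) (d d' : tree) (t : nat) : Prop :=
  exists2 s, run O c (update (fun=> Nil) 0 d) s t & s 0 = d'.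

Definition polytime_by (O : oracle) (c : command) (p : {poly nat})
    (I : Type) (code : I -> tree) (post : I -> tree -> Prop) : Prop :=
  forall i : I, exists d t,
    [/\ computes O c (code i) d t, t <= p.[tree_size (code i)]%R & post i d].

Definition polytime (I : Type) (code : I -> tree) (post : I -> tree -> Prop) :
    Prop :=
  exists (c : command) (p : {poly nat}), polytime_by no_oracle c p code post.

Record decision_problem := DecisionProblem {
  dinst : Type;
  dcode : dinst -> tree;
  dyes : dinst -> Prop
}.

Definition karp_reducible (A B : decision_problem) : Prop :=
  polytime (@dcode A)
    (fun i d => exists j : dinst B, d = dcode j /\ (dyes i <-> dyes j)).

Record search_problem := SearchProblem {
  sinst : Type;
  scode : sinst -> tree;
  ssol : sinst -> tree -> Prop
}.

Definition oracle_solves (O : oracle) (B : search_problem) : Prop :=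
  forall j : sinst B, exists2 d, O (scode j) = Some d & ssol j d.

(* A single program and time bound must work for all oracles solving B. *)
Definition turing_reducible (A B : search_problem) : Prop :=
  exists (c : command) (p : {poly nat}), forall O : oracle,
    oracle_solves O B -> polytime_by O c p (@scode A) (@ssol A).

(* Numbers are in unary: the sizes of a hypergraph and of its conflict graph
   G_k are polynomial in n, m and k themselves. *)
Definition code_nat (n : nat) : tree := iter n (Cons Nil) Nil.
Definition code_bool (b : bool) : tree := if b then Cons Nil Nil else Nil.
Definition code_seq (s : seq tree) : tree := foldr Cons Nil s.
Definition code_bits (s : seq bool) : tree := code_seq (map code_bool s).
Definition code_matrix (M : seq (seq bool)) : tree :=
  code_seq (map code_bits M).

(* A hypergraph with an arbitrary listing of its vertices and hyperedges. *)
Record listed_hypergraph := ListedHypergraph {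
  lh :> hypergraph;
  lh_vertices : seq lh;
  lh_edges : seq {set lh};
  lh_verticesP : perm_eq lh_vertices (enum lh);
  lh_edgesP : perm_eq lh_edges (enum (hedges lh))
}.

(* The number of vertices and the incidence matrix. *)
Definition code_hypergraph (H : listed_hypergraph) : tree :=
  Cons (code_nat #|lh H|)
    (code_matrix
      [seq [seq v \in e | v <- lh_vertices H] | e : {set lh H} <- lh_edges H]).

(* The adjacency matrix of G for the listing xs of its nodes. *)
Definition code_graph (G : sgraph) (xs : seq G) : tree :=
  code_matrix [seq [seq sadj x y | y <- xs] | x <- xs].

Record listed_conflict_graph := ListedConflictGraph {
  lg_hypergraph : hypergraph;
  lg_k : nat;
  lg_k_gt0 : 0 < lg_k;
  lg_nodes : seq (conflict_graph lg_hypergraph lg_k);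
  lg_nodesP : perm_eq lg_nodes (enum (conflict_graph lg_hypergraph lg_k))
}.

Definition lg_graph (G : listed_conflict_graph) : sgraph :=
  conflict_graph (lg_hypergraph G) (lg_k G).

Definition code_conflict_graph (G : listed_conflict_graph) : tree :=
  code_graph (lg_nodes G).

Record colouring_instance := ColouringInstance {
  ci_hypergraph :> listed_hypergraph;
  ci_k : nat;
  ci_k_gt0 : 0 < ci_k
}.

Definition code_colouring_instance (I : colouring_instance) : tree :=
  Cons (code_hypergraph I) (code_nat (ci_k I)).

Definition represents_graph (G : sgraph) (d : tree) : Prop :=
  exists2 xs : seq G, perm_eq xs (enum G) & d = code_graph xs.

(* Given H and k, is chi_cf(H) at most k? *)
Definition CF_DECISION : decision_problem :=
  @DecisionProblem colouring_instance code_colouring_instance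
    (fun I => chi_cf I <= ci_k I).

(* Given a conflict graph G and r, is alpha(G) at least r? *)
Definition MIS_DECISION : decision_problem :=
  @DecisionProblem (listed_conflict_graph * nat)
    (fun J => Cons (code_conflict_graph J.1) (code_nat J.2))
    (fun J => J.2 <= alpha (lg_graph J.1)).

(* Given H, find chi_cf(H) and a CF colouring with chi_cf(H) non-zero colours,
   as the list of the colours of the listed vertices. *)
Definition CF_SEARCH : search_problem :=
  @SearchProblem listed_hypergraph code_hypergraph
    (fun H d => exists2 C : {ffun H -> 'I_(chi_cf H).+1}, cf_colouring C &
       d = Cons (code_nat (chi_cf H))
             (code_seq [seq code_nat (C v) | v <- lh_vertices H])).

(* Given a conflict graph, find a maximum independent set, as the list of the
   membership bits of the listed nodes. *)
Definition MIS_SEARCH : search_problem :=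
  @SearchProblem listed_conflict_graph code_conflict_graph
    (fun G d => exists2 S : {set lg_graph G}, maximum_independent S &
       d = code_bits [seq x \in S | x <- lg_nodes G]).

(* Main.v *)
(* An independent set of G_k(H) contains at most one node per hyperedge.  One
   with m nodes gives a CF colouring: the vertex v of a chosen node (e, v, c)
   gets the colour c (E_vertex makes this unambiguous), all others get 0, and
   E_colour says that no other vertex of e has the colour c.  Conversely a CF
   colouring provides, for each hyperedge, a node witnessing it.  As
   alpha(G_k) <= m, this gives alpha(G_k) = m exactly if k colours suffice.

   For the complexity part, every tree is the list of the left subtrees on its
   right spine, and the functions computed by WHILE programs in polynomial time
   are closed under composition, pairing, conditionals and recursion along the
   right spine, provided that each step of the recursion increases the size of
   the result by an amount bounded polynomially in the other arguments.  The
   conflict graph is built from these operations; the search reduction queries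
   the oracle on G_1, ..., G_(n+1), and n + 1 colours always suffice. *)

From mathcomp Require Import all_boot ssralg poly zify.
(* Defs comes last because the seq library also exports Nil and Cons. *)
Require Import Defs.

Set Implicit Arguments.
Unset Strict Implicit.
Unset Printing Implicit Defensive.

(** * Polynomial time functions on trees *)

(** The base n + 2 is at least 2, so constants and sums are absorbed by a larger exponent.
    Monotonicity lets a bound be applied to an upper bound of its argument, as in a composition. *)
Definition poly_bound (T : nat -> nat) : Prop :=
  {homo T : m n / m <= n} /\ exists k, forall n, T n <= n.+2 ^ k.

Lemma poly_bound_id : poly_bound id.
Proof. by split=> //; exists 1 => n; rewrite expn1 ltnW. Qed.

Lemma poly_bound_const c : poly_bound (fun=> c).
Proof.
split=> //; exists c => n.
apply: leq_trans (ltnW (ltn_expl c (ltnSn 1))) _.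
by case: c => // c; rewrite leq_exp2r.
Qed.

Lemma poly_bound_add T U :
  poly_bound T -> poly_bound U -> poly_bound (fun n => T n + U n).
Proof.
move=> [mT [a bT]] [mU [b bU]]; split=> [m n mn|].
  by rewrite leq_add ?mT ?mU.
exists (a + b).+1 => n; rewrite expnS expnD.
apply: leq_trans (leq_add (bT n) (bU n)) _.
have : 0 < n.+2 ^ a by rewrite expn_gt0.
have : 0 < n.+2 ^ b by rewrite expn_gt0.
by nia.
Qed.

Lemma poly_bound_mul T U :
  poly_bound T -> poly_bound U -> poly_bound (fun n => T n * U n).
Proof.
move=> [mT [a bT]] [mU [b bU]]; split=> [m n mn|].
  by rewrite leq_mul ?mT ?mU.
by exists (a + b) => n; rewrite expnD leq_mul.
Qed.

Lemma poly_bound_comp T U :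
  poly_bound T -> poly_bound U -> poly_bound (fun n => T (U n)).
Proof.
move=> [mT [a bT]] [mU [b bU]]; split=> [m n mn|].
  by rewrite mT ?mU.
(* U n + 2 <= (n + 2) ^ b + 2 <= (n + 2) ^ (b + 2), which is then raised to the power a. *)
exists (b.+2 * a) => n; apply: leq_trans (bT _) _.
rewrite expnM; case: a {bT} => // a; rewrite leq_exp2r // !expnS.
have := bU n; have : 0 < n.+2 ^ b by rewrite expn_gt0.
by nia.
Qed.

Lemma poly_boundS T : poly_bound T -> poly_bound (fun n => (T n).+1).
Proof.
move=> pT; have := poly_bound_add pT (poly_bound_const 1).
by case=> m [k bk]; split=> [x y xy|]; [have := m _ _ xy; rewrite !addn1|
  exists k => n; rewrite -addn1].
Qed.

Lemma poly_bound_poly T :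
  poly_bound T -> exists p : {poly nat}, forall n, T n <= (p.[n])%R.
Proof.
move=> [_ [k bT]]; exists (('X + 2%N%:P) ^+ k)%R => n.
apply: leq_trans (bT n) _.
have -> : ((('X + 2%N%:P) ^+ k).[n])%R = n.+2 ^ k.
  rewrite horner_exp hornerD hornerX hornerC.
  elim: k {bT} => [|k IH]; first by rewrite GRing.expr0.
  by rewrite GRing.exprS expnS IH -(addn2 n); apply: erefl.
by [].
Qed.

Ltac poly_bound_tac :=
  repeat first
    [ assumption
    | match goal with |- poly_bound (fun _ => ?c) =>
        exact: (poly_bound_const c) end
    | exact: poly_bound_id
    | match goal with |- poly_bound (fun n => (@?T n).+1) =>
        apply: (@poly_boundS T) end
    | match goal with |- poly_bound (fun n => @?T n + @?U n) =>
        apply: (@poly_bound_add T U) end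
    | match goal with |- poly_bound (fun n => @?T n * @?U n) =>
        apply: (@poly_bound_mul T U) end
    | match goal with H : poly_bound ?T |- poly_bound (fun n => ?T (@?U n)) =>
        apply: (@poly_bound_comp T U H) end ].

(** * Programs with polynomial bounds and their composition *)

Lemma tree_size_gt0 d : 0 < tree_size d.
Proof. by case: d. Qed.

Lemma tree_size_hd d : tree_size (tree_hd d) <= tree_size d.
Proof. by case: d => //= l r; lia. Qed.

Lemma tree_size_tl d : tree_size (tree_tl d) <= tree_size d.
Proof. by case: d => //= l r; lia. Qed.

Lemma update_eq s x d : update s x d x = d.
Proof. by rewrite /update eqxx. Qed.

Lemma update_neq s x d y : y <> x -> update s x d y = s y.
Proof. by rewrite /update; case: eqP. Qed.

(** The initial store is arbitrary and the variables from N on are preserved, so that a larger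
    program can keep its own data there. The size of the result is bounded apart from the time,
    because a result copied from the input may be larger than the time spent. *)
Definition computes_in (c : command) (N : nat) (T : nat -> nat)
    (f : tree -> tree) : Prop :=
  forall O s, exists s' t,
    [/\ run O c s s' t, s' 0 = f (s 0), forall y, N <= y -> s' y = s y,
        t <= T (tree_size (s 0)) & tree_size (f (s 0)) <= T (tree_size (s 0))].

Definition polyfun (f : tree -> tree) : Prop :=
  exists c N T, poly_bound T /\ computes_in c N T f.

Lemma eq_polyfun f g : f =1 g -> polyfun f -> polyfun g.
Proof.
move=> fg [c [N [T [pT Hf]]]]; exists c, N, T; split=> // O s.
have [s' [t [r e fr bt bs]]] := Hf O s.
by exists s', t; rewrite -fg.
Qed.

Lemma polyfun_expr a f (B : nat -> nat) : poly_bound B ->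
  (forall s, eval s a = f (s 0)) ->
  (forall d, tree_size (f d) <= B (tree_size d)) -> polyfun f.
Proof.
move=> pB Ef Bf; exists (Assign 0 a), 1, (fun n => (B n).+1).
split; first by poly_bound_tac.
move=> O s; exists (update s 0 (eval s a)), (tree_size (eval s a)).+1.
split; rewrite ?update_eq ?Ef //.
- by rewrite -Ef; apply: RunAssign.
- by move=> y y0; rewrite update_neq //; lia.
- by rewrite ltnS.
- by rewrite leqW.
Qed.

Lemma polyfun_id : polyfun id.
Proof. exact: (@polyfun_expr (EVar 0) _ id poly_bound_id). Qed.

Lemma polyfun_nil : polyfun (fun=> Nil).
Proof. exact: (@polyfun_expr ENil _ _ (poly_bound_const 1)). Qed.

Lemma polyfun_comp f g :
  polyfun f -> polyfun g -> polyfun (fun z => g (f z)).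
Proof.
move=> [cf [Nf [Tf [pTf Hf]]]] [cg [Ng [Tg [pTg Hg]]]].
exists (Seq cf cg), (Nf + Ng), (fun n => Tf n + Tg (Tf n)).
split; first by poly_bound_tac.
move=> O s.
have [s1 [t1 [r1 e1 fr1 bt1 bs1]]] := Hf O s.
have [s2 [t2 [r2 e2 fr2 bt2 bs2]]] := Hg O s1.
have mT := proj1 pTg.
have leT := mT _ _ bs1.
exists s2, (t1 + t2); split.
- exact: RunSeq r1 r2.
- by rewrite e2 e1.
- by move=> y Ny; rewrite fr2 ?fr1 //; lia.
- by move: bt2; rewrite e1 => bt2; lia.
- by move: bs2; rewrite e1 => bs2; lia.
Qed.

Lemma polyfun_hd f : polyfun f -> polyfun (fun z => tree_hd (f z)).
Proof.
move=> pf; apply: polyfun_comp pf _.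
exact: (@polyfun_expr (EHd (EVar 0)) _ id poly_bound_id _ tree_size_hd).
Qed.

Lemma polyfun_tl f : polyfun f -> polyfun (fun z => tree_tl (f z)).
Proof.
move=> pf; apply: polyfun_comp pf _.
exact: (@polyfun_expr (ETl (EVar 0)) _ id poly_bound_id _ tree_size_tl).
Qed.

Ltac update_tac := repeat first
  [ rewrite update_eq | rewrite update_neq; [|by lia] ].

Lemma polyfun_cons f g :
  polyfun f -> polyfun g -> polyfun (fun z => Cons (f z) (g z)).
Proof.
move=> [cf [Nf [Tf [pTf Hf]]]] [cg [Ng [Tg [pTg Hg]]]].
(* Variable [M] saves the input and [M.+1] the value of [f]; both lie beyond what [cf] and [cg] may
   change. *)
have [M ME] : exists M, M = (Nf + Ng).+1 by exists (Nf + Ng).+1.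
exists (Seq (Assign M (EVar 0)) (Seq cf (Seq (Assign M.+1 (EVar 0))
  (Seq (Assign 0 (EVar M)) (Seq cg
    (Assign 0 (ECons (EVar M.+1) (EVar 0)))))))), M.+2,
  (fun n => n.+1 + (Tf n + ((Tf n).+1 + (n.+1 + (Tg n + (Tf n + Tg n).+2))))).
split; first by poly_bound_tac.
move=> O s.
have [s1 [t1 [r1 e1 fr1 bt1 bs1]]] := Hf O (update s M (s 0)).
have [s2 [t2 [r2 e2 fr2 bt2 bs2]]] :=
  Hg O (update (update s1 M.+1 (s1 0)) 0 (s 0)).
have s1M : s1 M = s 0 by rewrite fr1; [update_tac | lia].
have s2M : s2 M.+1 = s1 0 by rewrite fr2; [update_tac | lia].
have s00 : update s M (s 0) 0 = s 0 by update_tac.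
move: e1 bt1 bs1 e2 bt2 bs2; rewrite update_eq s00.
move=> e1 bt1 bs1 e2 bt2 bs2.
exists (update s2 0 (Cons (s1 0) (s2 0))),
  ((tree_size (s 0)).+1 + (t1 + ((tree_size (s1 0)).+1 +
    ((tree_size (s 0)).+1 + (t2 + (tree_size (Cons (s1 0) (s2 0))).+1))))).
split.
- apply: RunSeq; first exact: RunAssign.
  apply: RunSeq; first exact: r1.
  apply: RunSeq; first exact: RunAssign.
  have E : eval (update s1 M.+1 (s1 0)) (EVar M) = s 0.
    by rewrite /= update_neq //; lia.
  apply: RunSeq; first by rewrite -E; apply: RunAssign.
  apply: RunSeq; first by rewrite E; exact: r2.
  have E' : eval s2 (ECons (EVar M.+1) (EVar 0)) = Cons (s1 0) (s2 0).
    by rewrite /= s2M.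
  by rewrite -E'; apply: RunAssign.
- by rewrite update_eq e1 e2.
- move=> y Ny; update_tac; rewrite fr2; last lia.
  by update_tac; rewrite fr1; [update_tac | lia].
- by rewrite /= e1 e2; lia.
- by rewrite /=; lia.
Qed.

Lemma polyfun_if b f g : polyfun b -> polyfun f -> polyfun g ->
  polyfun (fun z => if is_cons (b z) then f z else g z).
Proof.
move=> pb pf pg.
(* Computing the test overwrites the input, so the test value is first paired with the input, and
   each branch projects the input back out. *)
suff: polyfun (fun z => if is_cons (tree_hd z) then f (tree_tl z)
                        else g (tree_tl z)).
  by apply: polyfun_comp (polyfun_cons pb polyfun_id).
have [cf [Nf [Tf [pTf Hf]]]] := polyfun_comp (polyfun_tl polyfun_id) pf.
have [cg [Ng [Tg [pTg Hg]]]] := polyfun_comp (polyfun_tl polyfun_id) pg.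
exists (If (EHd (EVar 0)) cf cg), (Nf + Ng), (fun n => (Tf n + Tg n).+1).
split; first by poly_bound_tac.
move=> O s; case: ifP => [c|/negbT c].
  have [s1 [t1 [r1 e1 fr1 bt1 bs1]]] := Hf O s.
  exists s1, t1.+1; split=> //; try by lia.
    exact: RunIfTrue.
  by move=> y Ny; apply: fr1; lia.
have [s1 [t1 [r1 e1 fr1 bt1 bs1]]] := Hg O s.
exists s1, t1.+1; split=> //; try by lia.
  exact: RunIfFalse.
by move=> y Ny; apply: fr1; lia.
Qed.

(** The invariant is indexed by the number of rounds still to come; each round costs at most K and
    one unit for the test. *)
Lemma run_while O a c (Inv : nat -> store -> Prop) (K : nat) :
  (forall s, Inv 0 s -> ~~ is_cons (eval s a)) ->
  (forall n s, Inv n.+1 s -> is_cons (eval s a) /\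
     exists s' t, [/\ run O c s s' t, Inv n s' & t <= K]) ->
  forall n s, Inv n s ->
  exists s' t, [/\ run O (While a c) s s' t, Inv 0 s' & t <= (n * K.+1).+1].
Proof.
move=> I0 IS; elim=> [|n IH] s Is.
  by exists s, 1; split=> //; apply: RunWhileFalse; apply: I0.
have [ca [s1 [t1 [r1 I1 b1]]]] := IS _ _ Is.
have [s2 [t2 [r2 I2 b2]]] := IH _ I1.
exists s2, (t1 + t2).+1; split=> //; first exact: RunWhileTrue r1 r2.
by rewrite mulSn; lia.
Qed.

(** * Recursion along the right spine *)

Fixpoint trec (z : tree) (F : tree -> tree -> tree -> tree) (d : tree) : tree :=
  if d is Cons x l then F x l (trec z F l) else z.

Fixpoint tlen (d : tree) : nat := if d is Cons _ l then (tlen l).+1 else 0.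

Lemma tlen_size d : tlen d <= tree_size d.
Proof. by elim: d => //= x _ l IH; lia. Qed.

Lemma iter_tl_cons n d : n < tlen d -> is_cons (iter n tree_tl d).
Proof.
elim: n d => [|n IH] [|x l] //; rewrite iterSr /=.
by rewrite ltnS; apply: IH.
Qed.

Lemma iter_tl_tlen d : iter (tlen d) tree_tl d = Nil.
Proof. by elim: d => // x _ l IH; rewrite iterSr. Qed.

Lemma tree_size_iter_tl n d : tree_size (iter n tree_tl d) <= tree_size d.
Proof. by elim: n => //= n IH; apply: leq_trans (tree_size_tl _) IH. Qed.

Lemma cons_hd_tl d : is_cons d -> d = Cons (tree_hd d) (tree_tl d).
Proof. by case: d. Qed.

(* The recursion proceeds from the innermost suffix outwards, so its program
   first pushes all suffixes on a stack. *)
Fixpoint suffix_stack (d : tree) (n : nat) : tree :=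
  if n is n'.+1 then Cons (iter n' tree_tl d) (suffix_stack d n') else Nil.

Lemma tree_size_suffix_stack d n :
  tree_size (suffix_stack d n) <= n * (tree_size d).+1 + 1.
Proof.
elim: n => //= n IH; have := tree_size_iter_tl n d.
by rewrite mulSn; lia.
Qed.

(** A step that doubled the accumulator would give results of exponential size. Here the growth is
    bounded independently of the accumulator, so the increments only add up. *)
Definition additive_step (F : tree -> tree -> tree -> tree -> tree) : Prop :=
  exists2 A, poly_bound A & forall e x l acc,
    tree_size (F e x l acc) <=
      tree_size acc + A (tree_size e + tree_size x + tree_size l).

Lemma tree_size_trec F A e z d : poly_bound A ->
  (forall x l acc, tree_size (F x l acc) <=
      tree_size acc + A (e + tree_size x + tree_size l)) ->
  tree_size (trec z F d) <= tree_size z + tlen d * A (e + tree_size d).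
Proof.
move=> [mA _] HF; elim: d => [|x _ l IH] /=; first by lia.
apply: leq_trans (HF _ _ _) _.
have := mA (e + tree_size x + tree_size l) (e + (tree_size x + tree_size l).+1).
have := mA (e + tree_size l) (e + (tree_size x + tree_size l).+1).
by nia.
Qed.

(** The input packs the parameter e, the initial value z and the list d. A first loop stacks the
    suffixes of d, leaving the shortest on top; a second one pops them and runs the program of the
    step on each, with the accumulator in variable 0. *)
Lemma polyfun_trec_base F : additive_step F ->
  polyfun (fun w => F (tree_hd w) (tree_hd (tree_tl w))
    (tree_hd (tree_tl (tree_tl w))) (tree_tl (tree_tl (tree_tl w)))) ->
  polyfun (fun w => trec (tree_hd (tree_tl w)) (F (tree_hd w))
    (tree_tl (tree_tl w))).
Proof.
move=> [A pA HA] [c [N [T [pT HT]]]].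
have [vE EE] : exists vE, vE = N.+1 by exists N.+1.
have [vS ES] : exists vS, vS = N.+2 by exists N.+2.
have [vD ED] : exists vD, vD = N.+3 by exists N.+3.
pose push := Seq (Assign vS (ECons (EVar vD) (EVar vS)))
                 (Assign vD (ETl (EVar vD))).
pose top := EHd (EVar vS).
pose pop := Seq (Assign 0 (ECons (EVar vE)
                   (ECons (EHd top) (ECons (ETl top) (EVar 0)))))
              (Seq c (Assign vS (ETl (EVar vS)))).
pose prog := Seq (Assign vE (EHd (EVar 0))) (Seq (Assign vS ENil)
  (Seq (Assign vD (ETl (ETl (EVar 0)))) (Seq (While (EVar vD) push)
  (Seq (Assign 0 (EHd (ETl (EVar 0)))) (While (EVar vS) pop))))).
(* For inputs of size n, [K1] bounds the time of a push, [Z] the size of the accumulator, [I] the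
   packed argument of the step and [K2] the time of a pop. *)
pose K1 n := (n * n.+1 + 1).+1 + n.+1.
pose Z n := n + n * A (n + n).
pose I n := (n + (n + n + Z n).+2).+1.
pose K2 n := (I n).+1 + (T (I n) + (n * n.+1 + 1).+1).
exists prog, N.+4, (fun n => n.+1 + (2 + (n.+1 + ((n * (K1 n).+1).+1 +
  (n.+1 + ((n * (K2 n).+1).+1 + Z n)))))).
have pZ : poly_bound Z by rewrite /Z; poly_bound_tac.
have pI : poly_bound I by rewrite /I; poly_bound_tac.
split; first by rewrite /K1 /K2; poly_bound_tac.
move=> O s.
set w := s 0; set e := tree_hd w; set z := tree_hd (tree_tl w).
set d := tree_tl (tree_tl w); set W := tree_size w.
have [eW zW dW] : [/\ tree_size e <= W, tree_size z <= W & tree_size d <= W].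
  have := tree_size_tl (tree_tl w); have := tree_size_hd (tree_tl w).
  have := tree_size_tl w; have := tree_size_hd w.
  by rewrite /e /z /d /W; split; lia.
have LW : tlen d <= W by apply: leq_trans (tlen_size d) dW.
have stkW n : n <= tlen d -> tree_size (suffix_stack d n) <= W * W.+1 + 1.
  by move=> nd; apply: leq_trans (tree_size_suffix_stack d n) _; nia.
have sufW n : tree_size (iter n tree_tl d) <= W.
  exact: leq_trans (tree_size_iter_tl n d) dW.
have recW n : tree_size (trec z (F e) (iter n tree_tl d)) <= Z W.
  apply: leq_trans (tree_size_trec _ _ pA (HA e)) _.
  have := tlen_size (iter n tree_tl d); have := sufW n.
  have := (proj1 pA) (tree_size e + tree_size (iter n tree_tl d)) (W + W).
  by rewrite /Z; nia.
pose s1 := update s vE e.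
pose s2 := update s1 vS Nil.
pose s3 := update s2 vD d.
have s30 : s3 0 = w by rewrite /s3 /s2 /s1; update_tac.
pose frame (s' : store) := forall y, N.+4 <= y -> s' y = s y.
(* With n pushes to come, [vD] holds the next suffix and the stack all longer ones. *)
pose Inv1 n (s' : store) := [/\ n <= tlen d,
  s' vD = iter (tlen d - n) tree_tl d, s' vS = suffix_stack d (tlen d - n),
  s' vE = e & s' 0 = w /\ frame s'].
have [] := @run_while O (EVar vD) push Inv1 (K1 W) _ _ (tlen d) s3.
- by move=> s' [_ /= -> _ _ _]; rewrite subn0 iter_tl_tlen.
- move=> n s' [nd D S E [w0 fr]]; split.
    by rewrite /= D; apply: iter_tl_cons; lia.
  have dn : tlen d - n = (tlen d - n.+1).+1 by lia.
  pose s4 := update s' vS (eval s' (ECons (EVar vD) (EVar vS))).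
  exists (update s4 vD (eval s4 (ETl (EVar vD)))).
  eexists; split; first by apply: RunSeq; apply: RunAssign.
    split; first by lia.
    + by rewrite /s4 /=; update_tac; rewrite D dn.
    + by rewrite /s4 /=; update_tac; rewrite D S dn.
    + by rewrite /s4; update_tac.
    + split=> [|y Ny]; first by rewrite /s4; update_tac.
      by rewrite /s4; update_tac; apply: fr.
  rewrite /s4 /=; update_tac.
  rewrite D S /K1.
  have := stkW (tlen d - n.+1).+1; rewrite /= => /(_ _).
  have := sufW (tlen d - n.+1).
  have := tree_size_tl (iter (tlen d - n.+1) tree_tl d).
  by lia.
- split; rewrite ?subnn //.
  + by rewrite /s3 /s2 /s1; update_tac.
  + by rewrite /s3 /s2 /s1; update_tac.
  + by rewrite /s3 /s2 /s1; update_tac.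
  + by split=> // y Ny; rewrite /s3 /s2 /s1; update_tac.
move=> s4 [t4 [r4 [_ _ S4 E4 [w4 fr4]] b4]].
pose s5 := update s4 0 z.
(* With n pops to come, the accumulator is the recursive value on d without its first n entries: z
   at the start, the full result at n = 0. *)
pose Inv2 n (s' : store) := [/\ n <= tlen d,
  s' 0 = trec z (F e) (iter n tree_tl d), s' vS = suffix_stack d n,
  s' vE = e & frame s'].
have [] := @run_while O (EVar vS) pop Inv2 (K2 W) _ _ (tlen d) s5.
- by move=> s' [_ _ /= -> _ _].
- move=> n s' [nd acc S E fr]; split; first by rewrite /= S.
  set suf := iter n tree_tl d in S.
  have csuf : is_cons suf by apply: iter_tl_cons.
  set r := Cons e (Cons (tree_hd suf) (Cons (tree_tl suf) (s' 0))).
  have er : eval s' (ECons (EVar vE)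
      (ECons (EHd top) (ECons (ETl top) (EVar 0)))) = r by rewrite /= S E.
  have [s6 [t6 [r6 e6 fr6 bt6 bs6]]] := HT O (update s' 0 r).
  exists (update s6 vS (eval s6 (ETl (EVar vS)))).
  eexists; split.
  + apply: RunSeq; first exact: RunAssign.
    by rewrite er; apply: RunSeq; [exact: r6|apply: RunAssign].
  + have sE : s6 vE = e by rewrite fr6; [update_tac | lia].
    have sS : s6 vS = s' vS by rewrite fr6; [update_tac | lia].
    split; first exact: ltnW.
    * update_tac; rewrite e6 update_eq /= acc -/suf.
      by rewrite (cons_hd_tl csuf).
    * by rewrite update_eq /= sS S.
    * by update_tac.
    * move=> y Ny; update_tac; rewrite fr6; last lia.
      by update_tac; apply: fr.
  + rewrite er /=.
    have sS : s6 vS = s' vS by rewrite fr6; [update_tac | lia].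
    have rI : tree_size r <= I W.
      have := sufW n; have := recW n.+1; rewrite -acc -/suf.
      have := tree_size_hd suf; have := tree_size_tl suf.
      by rewrite /r /I /=; lia.
    rewrite sS S /= /K2.
    have := stkW n (ltnW nd).
    have := proj1 pT _ _ rI.
    move: bt6; rewrite update_eq.
    by move: rI; rewrite /r /=; lia.
- split=> //.
  + by rewrite /s5 update_eq iter_tl_tlen.
  + by rewrite /s5; update_tac; rewrite S4 subn0.
  + by rewrite /s5; update_tac.
  + by move=> y Ny; rewrite /s5; update_tac; apply: fr4.
move=> s6 [t6 [r6 [_ res _ _ fr6] b6]].
exists s6; eexists; split.
- apply: RunSeq; first exact: RunAssign.
  apply: RunSeq; first exact: RunAssign.
  apply: RunSeq; first exact: RunAssign.
  have Ed : eval s2 (ETl (ETl (EVar 0))) = d.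
    by rewrite /s2 /s1 /=; update_tac.
  rewrite -/s1 -/s2 Ed; apply: RunSeq; first exact: r4.
  apply: RunSeq; first exact: RunAssign.
  by rewrite /= w4; exact: r6.
- exact: res.
- exact: fr6.
- have Ed : tree_tl (tree_tl (update (update s vE e) vS Nil 0)) = d.
    by update_tac.
  rewrite /= w4 Ed -/e -/z -/W; clear - eW zW dW b4 b6 LW.
  have : tlen d * (K1 W).+1 <= W * (K1 W).+1 by rewrite leq_mul2r LW orbT.
  have : tlen d * (K2 W).+1 <= W * (K2 W).+1 by rewrite leq_mul2r LW orbT.
  by lia.
- by have := recW 0 => /= h; apply: leq_trans h _; lia.
Qed.

(** The whole input serves as the parameter e, so the step, the initial value and the list may all
    depend on it. *)
Lemma polyfun_trec F z d : additive_step F ->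
  polyfun (fun w => F (tree_hd w) (tree_hd (tree_tl w))
    (tree_hd (tree_tl (tree_tl w))) (tree_tl (tree_tl (tree_tl w)))) ->
  polyfun z -> polyfun d -> polyfun (fun e => trec (z e) (F e) (d e)).
Proof.
move=> aF pF pz pd.
exact: polyfun_comp (polyfun_cons polyfun_id (polyfun_cons pz pd))
  (polyfun_trec_base aF pF).
Qed.

Lemma polyfun_size f : polyfun f ->
  exists2 T, poly_bound T & forall d, tree_size (f d) <= T (tree_size d).
Proof.
move=> [c [N [T [pT HT]]]]; exists T => // d.
by have [s' [t []]] := HT no_oracle (fun=> d).
Qed.

(** * List operations on trees *)

Definition tcat (a b : tree) : tree := trec b (fun x _ acc => Cons x acc) a.

Definition tmap (f : tree -> tree) (d : tree) : tree :=
  trec Nil (fun x _ acc => Cons (f x) acc) d.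

Definition tflat (f : tree -> tree) (d : tree) : tree :=
  trec Nil (fun x _ acc => tcat (f x) acc) d.

Definition trev (d : tree) : tree :=
  trec Nil (fun x _ acc => tcat acc (Cons x Nil)) d.

(* The sublist of d left after dropping as many entries as n has. *)
Definition tdrop (n d : tree) : tree := trec d (fun _ _ acc => tree_tl acc) n.

Definition tnth (d n : tree) : tree := tree_hd (tdrop n d).

(** In a unary number the tail after an entry is itself the code of a smaller number; collecting
    these tails from the inside lists 0, ..., n - 1 in increasing order. *)
Definition tiota (n : tree) : tree :=
  trec Nil (fun _ l acc => tcat acc (Cons l Nil)) n.

(** On unary numbers this is equality; on other lists it compares cardinalities. *)
Definition teqlen (a b : tree) : bool :=
  ~~ is_cons (tdrop a b) && ~~ is_cons (tdrop b a).

Lemma tcat_code a b : tcat (code_seq a) (code_seq b) = code_seq (a ++ b).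
Proof. by elim: a => //= x a <-. Qed.

Lemma tmap_code f s : tmap f (code_seq s) = code_seq (map f s).
Proof. by elim: s => //= x s <-. Qed.

Lemma tmap_map_code (T : Type) (c : T -> tree) f (g : T -> tree) s :
  (forall x, f (c x) = g x) -> tmap f (code_seq (map c s)) = code_seq (map g s).
Proof.
by move=> fg; rewrite tmap_code -map_comp; congr code_seq; apply: eq_map.
Qed.

Lemma tflat_code (T : Type) f (c : T -> tree) (g : T -> seq tree) s :
  (forall x, f (c x) = code_seq (g x)) ->
  tflat f (code_seq (map c s)) = code_seq (flatten (map g s)).
Proof.
by move=> fg; elim: s => //= x s IH; rewrite -tcat_code -IH -fg.
Qed.

Lemma trev_code s : trev (code_seq s) = code_seq (rev s).
Proof.
elim: s => // x s IH; rewrite rev_cons -cats1 -tcat_code -IH.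
by [].
Qed.

Lemma code_nat_seq n : code_nat n = code_seq (nseq n Nil).
Proof. by elim: n => //= n ->. Qed.

Lemma tmap_nil_code (T : Type) (s : seq T) f :
  tmap (fun=> Nil) (code_seq (map f s)) = code_nat (size s).
Proof.
by rewrite tmap_code code_nat_seq -map_comp; elim: s => //= x s [<-].
Qed.

Lemma tdrop_code n s :
  tdrop (code_seq n) (code_seq s) = code_seq (drop (size n) s).
Proof.
elim: n => [|x n IH] /=; first by rewrite drop0.
rewrite -[tdrop _ _]/(tree_tl (tdrop (code_seq n) (code_seq s))) IH.
by rewrite -addn1 addnC -drop_drop; case: (drop _ s) => //= y l; rewrite drop0.
Qed.

(** This includes positions past the end, where [tree_hd] of the empty list is the default [Nil]. *)
Lemma tnth_code s i : tnth (code_seq s) (code_nat i) = nth Nil s i.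
Proof.
rewrite /tnth code_nat_seq tdrop_code size_nseq.
rewrite -[i in RHS]addn0 -nth_drop; by case: (drop i s).
Qed.

Lemma tiota_code n : tiota (code_nat n) = code_seq (map code_nat (iota 0 n)).
Proof.
elim: n => // n IH; rewrite -addn1 iotaD add0n map_cat /= -tcat_code -IH addn1.
by [].
Qed.

Lemma teqlen_code a b : teqlen (code_seq a) (code_seq b) = (size a == size b).
Proof.
have ncons s : ~~ is_cons (code_seq s) = (size s == 0) by case: s.
by rewrite /teqlen !tdrop_code !ncons !size_drop !subn_eq0 andbC eqn_leq.
Qed.

Lemma teqlen_nat a b : teqlen (code_nat a) (code_nat b) = (a == b).
Proof. by rewrite !code_nat_seq teqlen_code !size_nseq. Qed.

Lemma tree_size_tcat a b : tree_size (tcat a b) <= tree_size a + tree_size b.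
Proof. by elim: a => //= x _ a; rewrite /tcat /=; lia. Qed.

Lemma is_cons_code_bool b : is_cons (code_bool b) = b.
Proof. by case: b. Qed.

Lemma size_code_seq s : size s <= tree_size (code_seq s).
Proof. by elim: s => //= x s; have := tree_size_gt0 x; lia. Qed.

Lemma tree_size_code_seq_mem (T : eqType) (g : T -> tree) s x : x \in s ->
  tree_size (g x) <= tree_size (code_seq (map g s)).
Proof.
elim: s => //= y s IH; rewrite inE => /predU1P[->|/IH]; first by lia.
by lia.
Qed.

Lemma tree_size_code_map (T : eqType) (g : T -> tree) s B :
  {in s, forall x, tree_size (g x) <= B} ->
  tree_size (code_seq (map g s)) <= (size s * B.+1).+1.
Proof.
elim: s => //= x s IH gB; have := gB x (mem_head _ _).
have /IH : {in s, forall y, tree_size (g y) <= B}.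
  by move=> y ys; apply: gB; rewrite inE ys orbT.
by rewrite mulSn; lia.
Qed.

Lemma tree_size_code_bits s : tree_size (code_bits s) <= (4 * size s).+1.
Proof.
have h : {in s, forall b, tree_size (code_bool b) <= 3} by case.
by apply: leq_trans (tree_size_code_map h) _; rewrite mulnC.
Qed.

(** * Closure under the list operations *)

Lemma additive_step_cons : additive_step (fun _ x _ acc => Cons x acc).
Proof.
exists (fun n => n.+1); first by poly_bound_tac.
by move=> e x l acc /=; lia.
Qed.

Lemma additive_step_tl : additive_step (fun _ _ _ acc => tree_tl acc).
Proof.
exists id; first exact: poly_bound_id.
by move=> e x l acc; have := tree_size_tl acc; lia.
Qed.

Ltac polyfun_struct :=
  match goal with
  | H : polyfun ?f |- polyfun ?f => exact: H
  | |- polyfun (fun z => z) => exact: polyfun_id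
  | |- polyfun tree_hd => exact: (polyfun_hd polyfun_id)
  | |- polyfun tree_tl => exact: (polyfun_tl polyfun_id)
  | |- polyfun (fun _ => Nil) => exact: polyfun_nil
  | |- polyfun (fun z => tree_hd (@?f z)) => apply: (@polyfun_hd f)
  | |- polyfun (fun z => tree_tl (@?f z)) => apply: (@polyfun_tl f)
  | |- polyfun (fun z => Cons (@?f z) (@?g z)) => apply: (@polyfun_cons f g)
  end.

Lemma polyfun_tcat f g :
  polyfun f -> polyfun g -> polyfun (fun z => tcat (f z) (g z)).
Proof.
move=> pf pg; apply: (@polyfun_trec (fun _ x _ acc => Cons x acc)) => //.
  exact: additive_step_cons.
by repeat polyfun_struct.
Qed.

Lemma polyfun_tdrop f g :
  polyfun f -> polyfun g -> polyfun (fun z => tdrop (f z) (g z)).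
Proof.
move=> pf pg; apply: (@polyfun_trec (fun _ _ _ acc => tree_tl acc)) => //.
  exact: additive_step_tl.
by repeat polyfun_struct.
Qed.

Lemma polyfun_tnth f g :
  polyfun f -> polyfun g -> polyfun (fun z => tnth (f z) (g z)).
Proof. by move=> pf pg; apply/polyfun_hd/polyfun_tdrop. Qed.

Lemma polyfun_comp2 (g : tree -> tree -> tree) f1 f2 :
  polyfun (fun w => g (tree_hd w) (tree_tl w)) -> polyfun f1 -> polyfun f2 ->
  polyfun (fun z => g (f1 z) (f2 z)).
Proof.
by move=> pg pf1 pf2; apply: polyfun_comp (polyfun_cons pf1 pf2) pg.
Qed.

(** The mapped function may use the surrounding input z besides the entry, which makes nested maps
    expressible. Each step adds one value of g, whose size is polynomial in that of z and the
    entry. *)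
Lemma polyfun_tmap (g : tree -> tree -> tree) f :
  polyfun (fun w => g (tree_hd w) (tree_tl w)) -> polyfun f ->
  polyfun (fun z => tmap (g z) (f z)).
Proof.
move=> pg pf; apply: (@polyfun_trec (fun e x _ acc => Cons (g e x) acc)).
- have [T pT bT] := polyfun_size pg.
  exists (fun n => (T n.+1).+1); first by poly_bound_tac.
  move=> e x l acc /=; have := bT (Cons e x) => /=.
  have := proj1 pT (tree_size e + tree_size x).+1
    (tree_size e + tree_size x + tree_size l).+1.
  by lia.
- apply: polyfun_cons; last by repeat polyfun_struct.
  by apply: (@polyfun_comp2 g tree_hd (fun w => tree_hd (tree_tl w)) pg);
    repeat polyfun_struct.
- exact: polyfun_nil.
- exact: pf.
Qed.

Lemma polyfun_tflat (g : tree -> tree -> tree) f :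
  polyfun (fun w => g (tree_hd w) (tree_tl w)) -> polyfun f ->
  polyfun (fun z => tflat (g z) (f z)).
Proof.
move=> pg pf; apply: (@polyfun_trec (fun e x _ acc => tcat (g e x) acc)).
- have [T pT bT] := polyfun_size pg.
  exists (fun n => T n.+1); first by poly_bound_tac.
  move=> e x l acc /=; have := bT (Cons e x) => /=.
  have := proj1 pT (tree_size e + tree_size x).+1
    (tree_size e + tree_size x + tree_size l).+1.
  by have := tree_size_tcat (g e x) acc; lia.
- apply: polyfun_tcat; last by repeat polyfun_struct.
  by apply: (@polyfun_comp2 g tree_hd (fun w => tree_hd (tree_tl w)) pg);
    repeat polyfun_struct.
- exact: polyfun_nil.
- exact: pf.
Qed.

Lemma polyfun_trev f : polyfun f -> polyfun (fun z => trev (f z)).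
Proof.
move=> pf.
apply: (@polyfun_trec (fun _ x _ acc => tcat acc (Cons x Nil))) => //.
- exists (fun n => n.+2); first by poly_bound_tac.
  by move=> e x l acc; have := tree_size_tcat acc (Cons x Nil) => /=; lia.
- by apply: polyfun_tcat; repeat polyfun_struct.
- exact: polyfun_nil.
Qed.

Lemma polyfun_tiota f : polyfun f -> polyfun (fun z => tiota (f z)).
Proof.
move=> pf.
apply: (@polyfun_trec (fun _ _ l acc => tcat acc (Cons l Nil))) => //.
- exists (fun n => n.+2); first by poly_bound_tac.
  by move=> e x l acc; have := tree_size_tcat acc (Cons l Nil) => /=; lia.
- by apply: polyfun_tcat; repeat polyfun_struct.
- exact: polyfun_nil.
Qed.

(** * Polynomial time predicates *)

Definition polypred (b : tree -> bool) : Prop :=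
  polyfun (fun z => code_bool (b z)).

Lemma polyfun_ite b f g : polypred b -> polyfun f -> polyfun g ->
  polyfun (fun z => if b z then f z else g z).
Proof.
move=> pb pf pg; apply: eq_polyfun (polyfun_if pb pf pg) => z.
by rewrite is_cons_code_bool.
Qed.

Lemma polyfun_true : polyfun (fun=> code_bool true).
Proof. exact: polyfun_cons polyfun_nil polyfun_nil. Qed.

Lemma polypred_cons f : polyfun f -> polypred (fun z => is_cons (f z)).
Proof.
by move=> pf; apply: eq_polyfun (polyfun_if pf polyfun_true polyfun_nil) => z;
  case: (f z).
Qed.

Lemma polypred_neg b : polypred b -> polypred (fun z => ~~ b z).
Proof.
by move=> pb; apply: eq_polyfun (polyfun_ite pb polyfun_nil polyfun_true) => z;
  case: (b z).
Qed.

Lemma polypred_and b c :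
  polypred b -> polypred c -> polypred (fun z => b z && c z).
Proof.
by move=> pb pc; apply: eq_polyfun (polyfun_ite pb pc polyfun_nil) => z;
  case: (b z).
Qed.

Lemma polypred_or b c :
  polypred b -> polypred c -> polypred (fun z => b z || c z).
Proof.
by move=> pb pc; apply: eq_polyfun (polyfun_ite pb polyfun_true pc) => z;
  case: (b z).
Qed.

Lemma polypred_teqlen f g :
  polyfun f -> polyfun g -> polypred (fun z => teqlen (f z) (g z)).
Proof.
by move=> pf pg; apply: polypred_and; apply/polypred_neg/polypred_cons;
  apply: polyfun_tdrop.
Qed.

Ltac polyfun_step :=
  match goal with
  | |- polyfun (fun z => code_bool (@?b z)) => change (polypred b)
  | |- polyfun (fun z => if _ then _ else _) => apply: polyfun_ite
  | |- polyfun (fun z => tcat (@?f z) (@?g z)) => apply: (@polyfun_tcat f g)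
  | |- polyfun (fun z => tnth (@?f z) (@?g z)) => apply: (@polyfun_tnth f g)
  | |- polyfun (fun z => tmap (@?g z) (@?f z)) => apply: (@polyfun_tmap g f)
  | |- polyfun (fun z => tflat (@?g z) (@?f z)) => apply: (@polyfun_tflat g f)
  | |- polyfun (fun z => trev (@?f z)) => apply: (@polyfun_trev f)
  | |- polyfun (fun z => tiota (@?f z)) => apply: (@polyfun_tiota f)
  | |- polypred (fun z => ~~ @?b z) => apply: (@polypred_neg b)
  | |- polypred (fun z => @?b z && @?c z) => apply: (@polypred_and b c)
  | |- polypred (fun z => @?b z || @?c z) => apply: (@polypred_or b c)
  | |- polypred (fun z => is_cons (@?f z)) => apply: (@polypred_cons f)
  | |- polypred (fun z => teqlen (@?f z) (@?g z)) =>
      apply: (@polypred_teqlen f g)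
  end.

Ltac polyfun_tac := repeat (cbv beta; first [polyfun_struct | polyfun_step]).

(** * The programs *)

(* A node (e, v, c) is handled through the positions of e and v in the
   listings, with the colour last. *)
Definition tvertex (x : tree) : tree := tree_hd (tree_tl x).
Definition tcolour (x : tree) : tree := tree_tl (tree_tl x).

Definition tincident (M i j : tree) : bool := is_cons (tnth (tnth M i) j).

(** The three disjuncts are [E_vertex], [E_edge] and [E_colour]. Since the vertex of a node lies in
    its hyperedge, the inclusion of both vertices in a hyperedge amounts to the membership of the
    other vertex. *)
Definition tadj (M x y : tree) : bool :=
  [|| teqlen (tvertex x) (tvertex y) && ~~ teqlen (tcolour x) (tcolour y),
      teqlen (tree_hd x) (tree_hd y) &&
        ~~ (teqlen (tvertex x) (tvertex y) && teqlen (tcolour x) (tcolour y))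
    | [&& teqlen (tcolour x) (tcolour y), ~~ teqlen (tvertex x) (tvertex y) &
        tincident M (tree_hd x) (tvertex y)
        || tincident M (tree_hd y) (tvertex x)]].

(** The range of hyperedge positions comes from the number of rows of M, and [Cons Nil] shifts the
    colours from 0, ..., k - 1 to 1, ..., k. *)
Definition tnodes (M n k : tree) : tree :=
  tflat (fun i =>
    tmap (fun q => Cons i q)
      (tflat (fun j =>
         tmap (fun c => Cons j c)
           (if tincident M i j then tmap (fun c => Cons Nil c) (tiota k)
            else Nil))
         (tiota n)))
    (tiota (tmap (fun=> Nil) M)).

Definition tgraph (M n k : tree) : tree :=
  tmap (fun x => tmap (fun y => code_bool (tadj M x y)) (tnodes M n k))
    (tnodes M n k).

Lemma polyfun_tnodes fM fn fk : polyfun fM -> polyfun fn -> polyfun fk ->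
  polyfun (fun z => tnodes (fM z) (fn z) (fk z)).
Proof.
move=> pM pn pk.
suff: polyfun (fun z => tnodes (tree_hd z) (tree_hd (tree_tl z))
                          (tree_tl (tree_tl z))).
  exact: polyfun_comp (polyfun_cons pM (polyfun_cons pn pk)).
by rewrite /tnodes /tincident; polyfun_tac.
Qed.

Lemma polyfun_tgraph fM fn fk : polyfun fM -> polyfun fn -> polyfun fk ->
  polyfun (fun z => tgraph (fM z) (fn z) (fk z)).
Proof.
move=> pM pn pk.
suff: polyfun (fun z =>
    tmap (fun x => tmap (fun y => code_bool (tadj (tree_hd z) x y))
      (tree_tl z)) (tree_tl z)).
  exact: polyfun_comp (polyfun_cons pM (polyfun_tnodes pM pn pk)).
by rewrite /tadj /tincident /tvertex /tcolour; polyfun_tac.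
Qed.

(* In decreasing order of k, since the query loop reverses its answers. *)
Definition tgraphs (h : tree) : tree :=
  trev (tmap (fun k => tgraph (tree_tl h) (tree_hd h) (Cons Nil k))
          (tiota (Cons Nil (tree_hd h)))).

(* Answers are numbered from 0: answer k is about the graph with k + 1
   colours. *)
Definition tselected (h ans k : tree) : tree :=
  tflat (fun p => if is_cons (tnth (tnth ans k) p)
                  then Cons (tnth (tnodes (tree_tl h) (tree_hd h) (Cons Nil k))
                               p) Nil
                  else Nil)
    (tiota (tmap (fun=> Nil) (tnodes (tree_tl h) (tree_hd h) (Cons Nil k)))).

(** The incidence matrix [tree_tl h] has one row per hyperedge, so the test asks for m selected
    nodes; the first index that passes is one less than the number of colours. *)
Definition tkmin (h ans : tree) : tree :=
  tree_hd (tflat (fun k => if teqlen (tselected h ans k) (tree_tl h)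
                           then Cons k Nil else Nil)
             (tiota (Cons Nil (tree_hd h)))).

(** A vertex of no selected node gets [tree_hd Nil], which is the code of colour 0. *)
Definition tcolours (n sel : tree) : tree :=
  tmap (fun j => tree_hd (tflat (fun x => if teqlen (tvertex x) j
                                          then Cons (tcolour x) Nil else Nil)
                            sel))
    (tiota n).

Definition tsolution (h ans : tree) : tree :=
  Cons (Cons Nil (tkmin h ans))
    (tcolours (tree_hd h) (tselected h ans (tkmin h ans))).

Lemma polyfun_tgraphs f : polyfun f -> polyfun (fun z => tgraphs (f z)).
Proof.
move=> pf; apply: (polyfun_comp pf).
rewrite /tgraphs; polyfun_tac.
by apply: polyfun_tgraph; polyfun_tac.
Qed.

Lemma polyfun_tselected fh fa fk : polyfun fh -> polyfun fa -> polyfun fk ->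
  polyfun (fun z => tselected (fh z) (fa z) (fk z)).
Proof.
move=> ph pa pk.
suff: polyfun (fun z => tselected (tree_hd z) (tree_hd (tree_tl z))
                          (tree_tl (tree_tl z))).
  exact: polyfun_comp (polyfun_cons ph (polyfun_cons pa pk)).
by rewrite /tselected; polyfun_tac; apply: polyfun_tnodes; polyfun_tac.
Qed.

Lemma polyfun_tsolution fh fa : polyfun fh -> polyfun fa ->
  polyfun (fun z => tsolution (fh z) (fa z)).
Proof.
move=> ph pa.
have pk : polyfun (fun z => tkmin (tree_hd z) (tree_tl z)).
  by rewrite /tkmin; polyfun_tac; apply: polyfun_tselected; polyfun_tac.
have ps : polyfun (fun z => tselected (tree_hd z) (tree_tl z)
                              (tkmin (tree_hd z) (tree_tl z))).
  by apply: polyfun_tselected => //; polyfun_tac.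
apply: (polyfun_comp2 _ ph pa).
apply: polyfun_cons; first by polyfun_tac.
apply: (@polyfun_comp2 tcolours) => //; last by polyfun_tac.
by rewrite /tcolours /tvertex /tcolour; polyfun_tac.
Qed.

(** * Independent sets of conflict graphs *)

Section IndependentSets.
Variables (H : hypergraph) (k : nat).
Let G := conflict_graph H k.
Implicit Types (S : {set G}) (x y : conflict_node H k).

Lemma node_edgeP x :
  [/\ node_edge x \in hedges H, node_vertex x \in node_edge x
    & 0 < node_colour x].
Proof. by case/and3P: (valP x). Qed.

Lemma node_eqE x y : (x == y) =
  [&& node_edge x == node_edge y, node_vertex x == node_vertex y
    & node_colour x == node_colour y].
Proof. by rewrite -val_eqE andbA. Qed.

Lemma independentP S :
  reflect {in S &, forall x y, ~~ conflict_adj x y} (independent S).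
Proof.
apply: (iffP forall_inP) => [h x y xS yS|h x xS].
  by have /forall_inP/(_ _ yS) := h _ xS.
by apply/forall_inP => y yS; apply: h.
Qed.

Lemma independent_edge_inj S :
  independent S -> {in S &, injective (@node_edge H k)}.
Proof.
move=> /independentP indS x y xS yS exy; apply/eqP.
apply: contraTT (indS x y xS yS) => nxy.
by rewrite negbK /conflict_adj /E_edge exy eqxx nxy orbT.
Qed.

Lemma independent_edges_sub S :
  [set node_edge x | x in S] \subset hedges H.
Proof. by apply/subsetP => _ /imsetP[x _ ->]; case: (node_edgeP x). Qed.

Lemma alpha_leq_edges : alpha G <= #|hedges H|.
Proof.
apply/bigmax_leqP => S indS.
rewrite -(card_in_imset (independent_edge_inj indS)).
exact: subset_leq_card (independent_edges_sub S).
Qed.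

(** Reading the colours from a list and taking the first match mirrors [tcolours], so the same
    function describes the output of the program. The default is colour 0. *)
Definition node_colouring (s : seq (conflict_node H k)) (v : H) : 'I_k.+1 :=
  head ord0 [seq node_colour x | x <- s & node_vertex x == v].

(** By [E_vertex], all nodes of S at one vertex have the same colour, so the order of s does not
    matter. *)
Lemma node_colouring_independent S s x : independent S -> s =i S ->
  x \in S -> node_colouring s (node_vertex x) = node_colour x.
Proof.
move=> /independentP indS sS xS; rewrite /node_colouring.
case E: (filter _ s) => [|y s'] /=.
  have : x \in [seq y <- s | node_vertex y == node_vertex x].
    by rewrite mem_filter eqxx sS.
  by rewrite E.
have : y \in [seq y <- s | node_vertex y == node_vertex x].
  by rewrite E mem_head.
rewrite mem_filter sS => /andP[vy yS].
apply/eqP; apply: contraTT (indS y x yS xS) => nxy.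
by rewrite negbK /conflict_adj /E_vertex vy nxy.
Qed.

Lemma node_colouring_neq0 s v : node_colouring s v != ord0 ->
  exists2 x, x \in s & node_vertex x = v.
Proof.
rewrite /node_colouring; case E: (filter _ s) => [|x s']; first by rewrite eqxx.
have : x \in [seq y <- s | node_vertex y == v] by rewrite E mem_head.
by rewrite mem_filter => /andP[/eqP vx xs] _; exists x.
Qed.

Lemma cf_colouring_independent S s :
  independent S -> s =i S -> #|S| = #|hedges H| ->
  cf_colouring [ffun v => node_colouring s v].
Proof.
move=> indS sS cardS; apply/forall_inP => e eH.
(* The m nodes of S have pairwise different hyperedges, so every hyperedge occurs. *)
have imS : [set node_edge x | x in S] = hedges H.
  apply/eqP; rewrite eqEcard independent_edges_sub.
  by rewrite (card_in_imset (independent_edge_inj indS)) cardS leqnn.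
move: eH; rewrite -imS => /imsetP[x xS ->].
have [_ vx cx] := node_edgeP x.
apply/existsP; exists (node_colour x); rewrite cx /=.
apply/cards1P; exists (node_vertex x); apply/setP => u.
rewrite !inE ffunE; apply/andP/eqP => [[ue /eqP cu]|->]; last first.
  by rewrite (node_colouring_independent indS sS xS).
(* The colour of x is non-zero, so u received it from a node y of S. As u lies in the hyperedge of
   x, [E_colour] would join x and y if u were another vertex. *)
have [|y ys vy] := @node_colouring_neq0 s u.
  by rewrite cu -val_eqE /= -lt0n.
have yS : y \in S by rewrite -sS.
move: cu; rewrite -vy (node_colouring_independent indS sS yS) => cu.
apply/eqP; apply: contraTT (independentP _ indS x y xS yS) => nuv.
rewrite negbK /conflict_adj /E_colour cu eqxx eq_sym nuv /=.
by rewrite subUset !sub1set vx vy ue !orbT.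
Qed.

Lemma alpha_colourable :
  (alpha G == #|hedges H|) = cf_colourable H k.
Proof.
apply/eqP/existsP => [aG|[C colC]].
  have : 0 < #|[pred S : {set G} | independent S]|.
    apply/card_gt0P; exists set0; rewrite inE.
    by apply/independentP => x y; rewrite inE.
  case/(eq_bigmax_cond (fun S : {set G} => #|S|)) => S indS cardS.
  exists [ffun v => node_colouring (enum S) v].
  apply: (cf_colouring_independent indS) => [x|]; first by rewrite mem_enum.
  by rewrite -cardS -aG.
pose good x :=
  node_edge x :&: [set v | C v == node_colour x] == [set node_vertex x].
(* One witness is picked per hyperedge, and S consists of the nodes picked for their own
   hyperedge. *)
pose choice (e : {set H}) := [pick x | good x && (node_edge x == e)].
pose S : {set G} := [set x | choice (node_edge x) == Some x].
have goodS x : x \in S -> good x.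
  by rewrite inE /choice; case: pickP => // y /andP[gy _] /eqP[<-].
have goodE x u : good x ->
    (u \in node_edge x) && (C u == node_colour x) = (u == node_vertex x).
  by move=> /eqP/setP/(_ u); rewrite !inE.
have colS x : x \in S -> C (node_vertex x) = node_colour x.
  move=> xS; have := goodE _ (node_vertex x) (goodS _ xS).
  by rewrite eqxx => /andP[_ /eqP].
(* The vertex of x is the only one of its colour in its hyperedge; this rules out [E_colour]. *)
have noclash x y : x \in S -> y \in S -> node_vertex y \in node_edge x ->
    node_colour x = node_colour y -> node_vertex x == node_vertex y.
  move=> xS yS yx cxy; rewrite eq_sym -(goodE _ _ (goodS _ xS)) yx.
  by rewrite (colS _ yS) cxy eqxx.
have indS : independent S.
  apply/independentP => x y xS yS; rewrite !negb_or; apply/and3P; split.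
  - rewrite /E_vertex; apply/negP => /andP[/eqP vxy].
    by rewrite -(colS _ xS) -(colS _ yS) vxy eqxx.
  - rewrite /E_edge; apply/negP => /andP[/eqP exy].
    move: xS yS; rewrite !inE exy => /eqP-> /eqP[->].
    by rewrite eqxx.
  - rewrite /E_colour; apply/negP => /and3P[/eqP cxy /negP nvxy].
    rewrite !subUset !sub1set => /orP[/andP[_ yx]|/andP[xy _]]; apply: nvxy.
      exact: noclash.
    by rewrite eq_sym; apply: noclash.
apply/eqP; rewrite eqn_leq alpha_leq_edges /=.
apply: leq_trans (leq_bigmax_cond _ indS).
rewrite -(card_in_imset (independent_edge_inj indS)); apply: subset_leq_card.
(* The unique vertex v of a colour j in e gives a good node over e, so the pick for e succeeds and e
   lies in the image of S. *)
apply/subsetP => e eH; have /existsP[j /andP[j0 /cards1P[v ev]]] :=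
  forall_inP colC e eH.
have ve : v \in e by have := set11 v; rewrite -ev inE => /andP[].
have xP : [&& e \in hedges H, v \in e & 0 < j] by rewrite eH ve.
pose x : conflict_node H k := Sub ((e, v), j) xP.
have gx : good x && (node_edge x == e).
  by rewrite /good /node_edge /node_colour /node_vertex !SubK /= ev !eqxx.
case E: (choice e) => [y|]; last first.
  by move: E; rewrite /choice; case: pickP => // /(_ x); rewrite gx.
have ey : node_edge y = e.
  by move: E; rewrite /choice; case: pickP => // z /andP[_ /eqP ze] [<-].
by apply/imsetP; exists y; rewrite // inE ey E.
Qed.

End IndependentSets.

(** * Colourability and the conflict-free chromatic number *)

Lemma cf_colourable_card H : cf_colourable H #|H|.
Proof.
apply/existsP; exists [ffun v : H => lift ord0 (enum_rank v)].
apply/forall_inP => e eH.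
have [v ve] : exists v, v \in e.
  by apply/set0Pn; apply: contraNneq (hedges_neq0 H) => <-.
apply/existsP; exists (lift ord0 (enum_rank v)); apply/cards1P; exists v.
apply/setP=> u; rewrite !inE ffunE (inj_eq lift_inj) (inj_eq enum_rank_inj).
by case: (u =P v) => [->|_]; rewrite ?ve ?andbF.
Qed.

Lemma cf_colourable_mono H j k :
  j <= k -> cf_colourable H j -> cf_colourable H k.
Proof.
rewrite -ltnS => jk /existsP[C /forall_inP colC].
have widen_inj : injective (widen_ord jk).
  by move=> x y /(congr1 val)/= /val_inj.
apply/existsP; exists [ffun v => widen_ord jk (C v)].
apply/forall_inP => e /colC/existsP[c /andP[c0 /eqP ec]].
apply/existsP; exists (widen_ord jk c); rewrite c0 /= -ec.
apply/eqP; congr #|pred_of_set (_ :&: _)|.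
by apply/setP => v; rewrite !inE ffunE (inj_eq widen_inj).
Qed.

Lemma chi_cf_gt0 H : 0 < chi_cf H.
Proof. by rewrite /chi_cf; case: ex_minnP => k /andP[]. Qed.

Lemma chi_cf_leq H k : 0 < k -> (chi_cf H <= k) = cf_colourable H k.
Proof.
move=> k0; rewrite /chi_cf; case: ex_minnP => j /andP[j0 cj] jmin.
apply/idP/idP => [jk|ck]; first exact: cf_colourable_mono cj.
by apply: jmin; rewrite k0.
Qed.

(** The successor accounts for a hypergraph without vertices, where [chi_cf] is still 1. *)
Lemma chi_cf_leq_card H : chi_cf H <= #|H|.+1.
Proof.
rewrite chi_cf_leq //; apply: cf_colourable_mono (cf_colourable_card H).
exact: leqnSn.
Qed.

(** For positive k, both alpha(G_k) = m and [chi_cf H <= k] say that H is colourable with k colours,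
    so both sides describe the least such k. *)
Lemma is_kmin_chi_cf H k : is_kmin H k <-> chi_cf H = k.
Proof.
split=> [[k0 /eqP ak kmin]|<-].
  apply/eqP; rewrite eqn_leq chi_cf_leq // -alpha_colourable ak /=.
  apply: kmin; first exact: chi_cf_gt0.
  by apply/eqP; rewrite alpha_colourable -chi_cf_leq ?chi_cf_gt0.
split=> [||j j0 /eqP]; first exact: chi_cf_gt0.
  by apply/eqP; rewrite alpha_colourable -chi_cf_leq ?chi_cf_gt0.
by rewrite alpha_colourable -chi_cf_leq.
Qed.

(** * Correctness of the programs *)

Definition incident (M : seq (seq bool)) (i j : nat) : bool :=
  nth false (nth [::] M i) j.

(** The nodes as triples of numbers, in the order in which [tnodes] produces them. *)
Definition node_triples (M : seq (seq bool)) (n k : nat) :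
    seq (nat * (nat * nat)) :=
  [seq (i, q) | i <- iota 0 (size M),
    q <- [seq (j, c) | j <- iota 0 n,
            c <- if incident M i j then map S (iota 0 k) else [::]]].

Definition triple_adj (M : seq (seq bool)) (x y : nat * (nat * nat)) : bool :=
  let: (i, (u, c)) := x in let: (j, (v, d)) := y in
  [|| (u == v) && (c != d), (i == j) && ~~ ((u == v) && (c == d))
    | [&& c == d, u != v & incident M i v || incident M j u]].

Definition code_triple (x : nat * (nat * nat)) : tree :=
  Cons (code_nat x.1) (Cons (code_nat x.2.1) (code_nat x.2.2)).

Lemma mem_node_triples M n k i j c : ((i, (j, c)) \in node_triples M n k) =
  [&& i < size M, j < n, incident M i j & 0 < c <= k].
Proof.
apply/allpairsPdep/and4P => [[i' [q [i'M /allpairsPdep[j' [c' []]]]]]|].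
  move: i'M; rewrite !mem_iota /= => iM jn cP -> [-> -> ->]; split=> //.
    by case: ifP cP.
  by case: ifP cP => // _ /mapP[d]; rewrite mem_iota => dk ->.
move=> [iM jn inc /andP[c0 ck]]; exists i, (j, c); split=> //.
  by rewrite mem_iota.
apply/allpairsPdep; exists j, c; rewrite mem_iota inc; split=> //.
by apply/mapP; exists c.-1; rewrite ?mem_iota ?prednK //= add0n prednK.
Qed.

Lemma node_triples_uniq M n k : uniq (node_triples M n k).
Proof.
apply: allpairs_uniq_dep => [|i _|[i p] [j q] _ _ /= [-> ->] //].
  exact: iota_uniq.
apply: allpairs_uniq_dep => [|j _|[u c] [v d] _ _ /= [-> ->] //].
  exact: iota_uniq.
by case: ifP => // _; rewrite map_inj_uniq ?iota_uniq //; apply: succn_inj.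
Qed.

Lemma tincident_code M i j :
  tincident (code_matrix M) (code_nat i) (code_nat j) = incident M i j.
Proof.
rewrite /tincident tnth_code.
(* Positions out of range agree as well: [Nil] codes both the empty row and [false]. *)
have -> : nth Nil (map code_bits M) i = code_bits (nth [::] M i).
  case: (ltnP i (size M)) => iM; first by rewrite (nth_map [::]).
  by rewrite !nth_default ?size_map //.
rewrite tnth_code -[Nil]/(code_bool false) /incident.
move: (nth [::] M i) => r; case: (ltnP j (size r)) => jr.
  by rewrite (nth_map false) // is_cons_code_bool.
by rewrite !nth_default ?size_map //.
Qed.

Lemma tnodes_code M n k : tnodes (code_matrix M) (code_nat n) (code_nat k) =
  code_seq (map code_triple (node_triples M n k)).
Proof.
rewrite /tnodes tmap_nil_code (tiota_code (size M)).
rewrite (@tflat_code _ _ code_nat (fun i => map code_triple [seq (i, q) | q <-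
  [seq (j, c) | j <- iota 0 n,
     c <- if incident M i j then map S (iota 0 k) else [::]]])) => [|i].
  by rewrite /node_triples map_flatten -map_comp.
pose code_pair q := Cons (code_nat q.1) (code_nat q.2).
rewrite -map_comp -(@tmap_map_code _ code_pair (Cons (code_nat i))) //.
congr tmap; rewrite (tiota_code n).
rewrite (@tflat_code _ _ code_nat (fun j => map code_pair [seq (j, c) |
     c <- if incident M i j then map S (iota 0 k) else [::]])) => [|j].
  by rewrite map_flatten -map_comp.
rewrite -map_comp -(@tmap_map_code _ code_nat (Cons (code_nat j))) //.
congr tmap; rewrite tincident_code; case: ifP => // _.
by rewrite tiota_code -map_comp; apply: tmap_map_code.
Qed.

Lemma tadj_code M x y :
  tadj (code_matrix M) (code_triple x) (code_triple y) = triple_adj M x y.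
Proof.
case: x y => [i [u c]] [j [v d]].
by rewrite /tadj /tvertex /tcolour /= !teqlen_nat !tincident_code.
Qed.

Lemma tgraph_code M n k : tgraph (code_matrix M) (code_nat n) (code_nat k) =
  code_matrix [seq [seq triple_adj M x y | y <- node_triples M n k]
              | x <- node_triples M n k].
Proof.
rewrite /tgraph tnodes_code /code_matrix -map_comp; apply: tmap_map_code => x.
rewrite /= /code_bits -map_comp; apply: tmap_map_code => y.
by rewrite tadj_code.
Qed.

(** * Nodes and their positions in the listings *)

Lemma eq_index (T : eqType) (s : seq T) x y :
  x \in s -> (index x s == index y s) = (x == y).
Proof.
move=> xs; apply/eqP/eqP => [exy|-> //].
have ys : y \in s by rewrite -index_mem -exy index_mem.
by rewrite -(nth_index x xs) exy nth_index.
Qed.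

(** Serves to pull the list of number triples back to a list of nodes. *)
Lemma map_onto (T : Type) (U : eqType) (f : T -> U) s :
  {in s, forall y, exists x, f x = y} -> exists xs, map f xs = s.
Proof.
elim: s => [|y s IH] onto; first by exists [::].
have [|xs <-] := IH; first by move=> z zs; apply: onto; rewrite inE zs orbT.
have [x <-] := onto y (mem_head _ _).
by exists (x :: xs).
Qed.

Section Listing.
Variables (H : listed_hypergraph) (k : nat).
Let es := lh_edges H.
Let vs := lh_vertices H.

Definition incidence_matrix : seq (seq bool) :=
  [seq [seq v \in e | v <- vs] | e : {set lh H} <- es].

Definition node_index (x : conflict_node H k) : nat * (nat * nat) :=
  (index (node_edge x) es, (index (node_vertex x) vs, node_colour x : nat)).

Lemma mem_lh_vertices v : v \in vs.
Proof. by rewrite (perm_mem (lh_verticesP H)) mem_enum. Qed.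

Lemma mem_lh_edges e : (e \in es) = (e \in hedges H).
Proof. by rewrite (perm_mem (lh_edgesP H)) mem_enum. Qed.

Lemma lh_vertices_uniq : uniq vs.
Proof. by rewrite (perm_uniq (lh_verticesP H)) enum_uniq. Qed.

Lemma lh_edges_uniq : uniq es.
Proof. by rewrite (perm_uniq (lh_edgesP H)) enum_uniq. Qed.

Lemma size_lh_vertices : size vs = #|lh H|.
Proof. by rewrite (perm_size (lh_verticesP H)) -cardE. Qed.

Lemma size_lh_edges : size es = #|hedges H|.
Proof. by rewrite (perm_size (lh_edgesP H)) -cardE. Qed.

Lemma incident_index e v : e \in es ->
  incident incidence_matrix (index e es) (index v vs) = (v \in e).
Proof.
move=> ees; rewrite /incident (nth_map e) ?index_mem //.
rewrite (nth_map v) ?index_mem ?mem_lh_vertices //.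
by rewrite !nth_index ?mem_lh_vertices.
Qed.

Lemma node_index_inj : injective node_index.
Proof.
move=> x y [/eqP ee /eqP ev ec]; apply/eqP; rewrite node_eqE.
have [eH _ _] := node_edgeP x.
rewrite -(eq_index (s := es)) ?mem_lh_edges // ee.
by rewrite -(eq_index (s := vs)) ?mem_lh_vertices // ev -val_eqE /= ec /=.
Qed.

Lemma node_index_adj x y : conflict_adj x y =
  triple_adj incidence_matrix (node_index x) (node_index y).
Proof.
have [ex vx _] := node_edgeP x; have [ey vy _] := node_edgeP y.
rewrite /= !eq_index ?mem_lh_edges ?mem_lh_vertices //.
rewrite !incident_index ?mem_lh_edges // /conflict_adj.
rewrite /E_vertex /E_edge /E_colour node_eqE !subUset !sub1set vx vy andbT /=.
(* The sides differ only in how distinctness of nodes is tested: for equal hyperedges it is a matter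
   of vertex and colour. *)
by case: (node_edge x =P node_edge y).
Qed.

Lemma node_index_mem x :
  node_index x \in node_triples incidence_matrix #|lh H| k.
Proof.
have [ex vx cx] := node_edgeP x.
rewrite mem_node_triples size_map index_mem mem_lh_edges ex.
rewrite -size_lh_vertices index_mem mem_lh_vertices.
rewrite incident_index ?mem_lh_edges //.
by rewrite vx cx -ltnS ltn_ord.
Qed.

Lemma node_index_onto p :
  p \in node_triples incidence_matrix #|lh H| k -> exists x, node_index x = p.
Proof.
case: p => i [j c]; rewrite mem_node_triples size_map -size_lh_vertices.
case/and4P => iE jV inc /andP[c0 ck].
have [v0 _] : exists v0, v0 \in vs.
  by case: (vs) jV => // v0 s _; exists v0; rewrite mem_head.
set e := nth set0 es i; set v := nth v0 vs j.
have ei : index e es = i by rewrite index_uniq ?lh_edges_uniq.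
have vj : index v vs = j by rewrite index_uniq ?lh_vertices_uniq.
have ees : e \in es by rewrite mem_nth.
move: inc; rewrite -ei -vj incident_index // => ve.
have xP : [&& e \in hedges H, v \in e & 0 < (inord c : 'I_k.+1)].
  by rewrite -mem_lh_edges ees ve inordK.
exists (Sub ((e, v), inord c) xP).
by rewrite /node_index /node_edge /node_vertex /node_colour !SubK /= inordK.
Qed.

Lemma node_listing : exists2 xs : seq (conflict_graph H k),
  perm_eq xs (enum (conflict_graph H k)) &
  map node_index xs = node_triples incidence_matrix #|lh H| k.
Proof.
have [xs Exs] := map_onto node_index_onto; exists xs => //.
have uxs : uniq xs.
  by apply: (@map_uniq _ _ node_index); rewrite Exs node_triples_uniq.
apply: uniq_perm (enum_uniq _) _ => // x.
by rewrite mem_enum -(mem_map node_index_inj) Exs node_index_mem.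
Qed.

Lemma code_graph_listing (xs : seq (conflict_graph H k)) :
  map node_index xs = node_triples incidence_matrix #|lh H| k ->
  code_graph xs =
  tgraph (code_matrix incidence_matrix) (code_nat #|lh H|) (code_nat k).
Proof.
move=> Exs; rewrite tgraph_code -Exs /code_graph -map_comp.
congr code_matrix; apply: eq_map => x /=; rewrite -map_comp.
by apply: eq_map => y; apply: node_index_adj.
Qed.

End Listing.

Lemma code_hypergraphE (H : listed_hypergraph) :
  code_hypergraph H =
  Cons (code_nat #|lh H|) (code_matrix (incidence_matrix H)).
Proof. by []. Qed.

Lemma tgraph_represents (H : listed_hypergraph) k :
  represents_graph (conflict_graph H k)
    (tgraph (tree_tl (code_hypergraph H)) (tree_hd (code_hypergraph H))
       (code_nat k)).
Proof.
have [xs pxs Exs] := node_listing H k; exists xs => //.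
by rewrite (code_graph_listing Exs).
Qed.

(** * Construction of the graph and the many-one reduction *)

Lemma polytime_polyfun f (I : Type) (code : I -> tree) post : polyfun f ->
  (forall i, post i (f (code i))) -> polytime code post.
Proof.
move=> [c [N [T [pT HT]]]] fpost; have [p Tp] := poly_bound_poly pT.
exists c, p => i.
have [s [t [r e _ bt _]]] := HT no_oracle (update (fun=> Nil) 0 (code i)).
exists (f (code i)), t; split=> //.
  by exists s => //; rewrite e update_eq.
by apply: leq_trans bt _; rewrite update_eq.
Qed.

Lemma conflict_graph_polytime : polytime code_colouring_instance
  (fun I d => represents_graph (conflict_graph I (ci_k I)) d).
Proof.
apply: (@polytime_polyfun (fun z =>
    tgraph (tree_tl (tree_hd z)) (tree_hd (tree_hd z)) (tree_tl z))).
  by apply: polyfun_tgraph; polyfun_tac.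
by move=> I; apply: tgraph_represents.
Qed.

(** The pair (H, k) is sent to G_k(H) with threshold m. As alpha(G_k) <= m always, reaching the
    threshold means equality, hence colourability with k colours. *)
Lemma cf_karp_mis : karp_reducible CF_DECISION MIS_DECISION.
Proof.
apply: (@polytime_polyfun (fun z => Cons
    (tgraph (tree_tl (tree_hd z)) (tree_hd (tree_hd z)) (tree_tl z))
    (tmap (fun=> Nil) (tree_tl (tree_hd z))))).
  apply: polyfun_cons; last by polyfun_tac.
  by apply: polyfun_tgraph; polyfun_tac.
move=> I; have [xs pxs Exs] := node_listing I (ci_k I).
exists (ListedConflictGraph (ci_k_gt0 I) pxs, #|hedges I|); split.
  rewrite /= /code_conflict_graph /= (code_graph_listing Exs); congr Cons.
  by rewrite tmap_nil_code size_map size_lh_edges.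
rewrite /= /lg_graph /= chi_cf_leq ?ci_k_gt0 // -alpha_colourable.
by rewrite eqn_leq alpha_leq_edges.
Qed.

(** * Decoding the answers of the oracle *)

Lemma flatten_nth_filter (T : Type) (c : T -> tree) (P : T -> bool) xs :
  flatten [seq if nth false (map P xs) p then [:: nth Nil (map c xs) p]
               else [::] | p <- iota 0 (size xs)] = map c (filter P xs).
Proof.
elim: xs => //= x xs IH; rewrite -[1]/(1 + 0) iotaDl -map_comp.
by case: (P x); rewrite /= -IH.
Qed.

Lemma tselected_code (T : Type) (c : T -> tree) (P : T -> bool) xs n M ans k :
  tnodes M n (Cons Nil k) = code_seq (map c xs) ->
  tnth ans k = code_bits (map P xs) ->
  tselected (Cons n M) ans k = code_seq (map c (filter P xs)).
Proof.
rewrite /tselected /= => -> ->; rewrite tmap_nil_code tiota_code.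
rewrite -flatten_nth_filter; apply: tflat_code => p.
rewrite tnth_code tnth_code.
rewrite -[Nil in nth Nil (map code_bool _)]/(code_bool false).
have -> : nth (code_bool false) (map code_bool (map P xs)) p =
          code_bool (nth false (map P xs) p).
  case: (ltnP p (size xs)) => px; first by rewrite (nth_map false) ?size_map.
  by rewrite !nth_default ?size_map.
by rewrite is_cons_code_bool; case: nth.
Qed.

(** The common pattern of [tkmin] and [tcolours]: a search for the first entry that passes a test,
    with [Nil] when there is none. *)
Lemma tree_hd_filter (T : eqType) (t : T -> tree) (b : tree -> bool)
    (P : pred T) (c : T -> tree) (f : tree -> tree) s :
  {in s, forall x, b (t x) = P x} ->
  {in s, forall x, f (t x) = c x} ->
  tree_hd (tflat (fun x => if b x then Cons (f x) Nil else Nil)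
             (code_seq (map t s))) = head Nil (map c (filter P s)).
Proof.
elim: s => //= x s IH bP fc.
pose F y := if b y then Cons (f y) Nil else Nil.
rewrite -[tflat _ _]/(tcat (F (t x)) (tflat F (code_seq (map t s)))) /F.
rewrite bP ?mem_head //; case: ifP => _ /=; first by rewrite fc ?mem_head.
by apply: IH => y ys; [apply: bP | apply: fc]; rewrite inE ys orbT.
Qed.

(** The range is cut at c: by minimality nothing below c survives the filter, and c heads the
    rest. *)
Lemma head_filter_iota (P : pred nat) n c : c < n -> P c ->
  (forall i, P i -> c <= i) -> head 0 (filter P (iota 0 n)) = c.
Proof.
move=> cn Pc cmin; rewrite -(subnKC (ltnW cn)) iotaD filter_cat.
have -> : filter P (iota 0 c) = [::].
  apply/eqP; rewrite -size_eq0 size_filter -leqn0 leqNgt -has_count.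
  apply/hasPn => i; rewrite mem_iota /= add0n => ic.
  by apply: contraL ic => /cmin; rewrite -leqNgt.
have -> : n - c = (n - c.+1).+1 by lia.
by rewrite /= add0n Pc.
Qed.

(** A correct answer for the graph with i + 1 colours, its bits referring to the order of
    [node_triples]. *)
Definition mis_answer (H : listed_hypergraph) (i : nat) (d : tree) : Prop :=
  exists xs (S : {set conflict_graph H i.+1}),
    [/\ perm_eq xs (enum (conflict_graph H i.+1)),
        map (@node_index H i.+1) xs =
          node_triples (incidence_matrix H) #|lh H| i.+1,
        maximum_independent S & d = code_bits [seq x \in S | x <- xs]].

Lemma tselected_answer (H : listed_hypergraph) (ans : nat -> tree) i :
  i <= #|lh H| -> mis_answer H i (ans i) ->
  exists (S : {set conflict_graph H i.+1}) s,
    [/\ independent S, #|S| = alpha (conflict_graph H i.+1), s =i S,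
        size s = #|S| &
        tselected (code_hypergraph H)
          (code_seq (map ans (iota 0 #|lh H|.+1))) (code_nat i) =
        code_seq (map (code_triple \o @node_index H i.+1) s)].
Proof.
move=> iH [xs [S [pxs Exs /andP[indS /eqP cardS] Ed]]].
exists S, (filter (mem S) xs); split=> //.
- by move=> x; rewrite mem_filter (perm_mem pxs) mem_enum andbT.
- by rewrite size_filter (permP pxs) enumT cardE /enum_mem size_filter.
- rewrite code_hypergraphE; apply: tselected_code.
    by rewrite -[Cons Nil _]/(code_nat i.+1) tnodes_code -Exs -map_comp.
  by rewrite tnth_code (nth_map 0) ?size_iota // nth_iota // add0n.
Qed.

Lemma tsolution_correct (H : listed_hypergraph) (ans : nat -> tree) :
  (forall i, i <= #|lh H| -> mis_answer H i (ans i)) ->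
  ssol (s := CF_SEARCH) H
    (tsolution (code_hypergraph H) (code_seq (map ans (iota 0 #|lh H|.+1)))).
Proof.
move=> Hans; set A := code_seq _.
have chiE : (chi_cf H).-1.+1 = chi_cf H by rewrite prednK ?chi_cf_gt0.
have chiH : (chi_cf H).-1 <= #|lh H| by rewrite -ltnS chiE chi_cf_leq_card.
(* Answer i selects a maximum independent set, which has m nodes exactly when i + 1 colours suffice;
   the least such i is [(chi_cf H).-1], within the range searched by [chiH]. *)
have kminE : tkmin (code_hypergraph H) A = code_nat (chi_cf H).-1.
  rewrite /tkmin code_hypergraphE [tree_hd (Cons _ _)]/=.
  rewrite -[Cons Nil _]/(code_nat #|lh H|.+1) tiota_code -code_hypergraphE.
  rewrite (@tree_hd_filter _ code_nat _ (fun i => cf_colourable H i.+1)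
             code_nat id) // => [|i]; last first.
    rewrite mem_iota add0n /= ltnS => iH.
    have [S [s [indS cardS sS sizes ->]]] := tselected_answer iH (Hans i iH).
    rewrite teqlen_code size_map sizes cardS !size_map size_lh_edges.
    exact: alpha_colourable.
  transitivity (code_nat (head 0 [seq i <- iota 0 #|lh H|.+1 |
    cf_colourable H i.+1])); first by case: (filter _ _).
  congr code_nat; apply: head_filter_iota => //.
    by rewrite chiE -chi_cf_leq ?chi_cf_gt0.
  by move=> i; rewrite -chi_cf_leq // -[in chi_cf H <= _]chiE.
rewrite /tsolution kminE.
have [S [s [indS cardS sS sizes ->]]] := tselected_answer chiH (Hans _ chiH).
rewrite -[Cons Nil _]/(code_nat (chi_cf H).-1.+1).
have colC : cf_colouring [ffun v => node_colouring s v].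
  apply: (cf_colouring_independent indS sS); rewrite cardS.
  by apply/eqP; rewrite alpha_colourable chiE -chi_cf_leq ?chi_cf_gt0.
suff Ed : tcolours (tree_hd (code_hypergraph H))
    (code_seq (map (code_triple \o @node_index H _) s)) =
    code_seq [seq code_nat (node_colouring s v) | v <- lh_vertices H].
  (* The number of colours occurs in the type of s, so s is generalised before [(chi_cf H).-1.+1] is
     replaced by [chi_cf H]. *)
  rewrite Ed; move: s colC {S indS cardS sS sizes Ed}; rewrite chiE => s colC.
  exists [ffun v => node_colouring s v] => //.
  by congr (Cons _ (code_seq _)); apply: eq_map => v; rewrite ffunE.
rewrite /tcolours code_hypergraphE /= tiota_code -size_lh_vertices.
(* The positions are written as indices of the listed vertices, which turns the comparison of
   numbers into one of vertices. *)
have <- : [seq index v (lh_vertices H) | v <- lh_vertices H] =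
    iota 0 (size (lh_vertices H)).
  apply: (@eq_from_nth _ 0); rewrite ?size_map ?size_iota // => i iV.
  have [v0 _] : exists v0, v0 \in lh_vertices H.
    by case: (lh_vertices H) iV => // v0 l _; exists v0; rewrite mem_head.
  by rewrite (nth_map v0) // nth_iota // index_uniq // lh_vertices_uniq.
rewrite -map_comp; apply: tmap_map_code => v /=.
rewrite (@tree_hd_filter _ _ _ (fun x => node_vertex x == v) (fun x =>
  code_nat (node_colour x))) //.
  by rewrite /node_colouring; case: (filter _ _).
move=> x _; rewrite /tvertex /= teqlen_nat.
by rewrite eq_index ?mem_lh_vertices.
Qed.

(** * The oracle reduction *)

Definition query_loop : command :=
  While (EVar 1) (Seq (Query 3 (EHd (EVar 1)))
    (Seq (Assign 2 (ECons (EVar 3) (EVar 2))) (Assign 1 (ETl (EVar 1))))).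

Definition answer (O : oracle) (d : tree) : tree := odflt Nil (O d).

(** Variable 1 holds the remaining queries, 2 the answers with the latest first, 3 the current
    answer. A round is charged for one query, the remaining queries, its answer twice and the
    accumulated answers, which grow by at most B + 1 per round. *)
Lemma run_query_loop O (T : eqType) (g : T -> tree) B xs acc s :
  {in xs, forall x, O (g x) = Some (answer O (g x))} ->
  {in xs, forall x, tree_size (answer O (g x)) <= B} ->
  s 1 = code_seq (map g xs) -> s 2 = code_seq acc ->
  exists s' t, [/\ run O query_loop s s' t, s' 0 = s 0,
    s' 2 = code_seq (catrev (map (answer O \o g) xs) acc) &
    t <= (size xs * (2 * tree_size (code_seq (map g xs)) + 2 * B +
           tree_size (code_seq acc) + size xs * B.+1 + 5)).+1].
Proof.
elim: xs acc s => [|x xs IH] acc s Og Bg s1 s2.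
  exists s, 1; split=> //; apply: RunWhileFalse.
  by rewrite /= s1.
have Eg := Og x (mem_head _ _); have gB := Bg x (mem_head _ _).
set d := answer O (g x) in Eg gB.
set sa := update s 3 d.
set sb := update sa 2 (Cons d (code_seq acc)).
set sc := update sb 1 (code_seq (map g xs)).
have [||||s' [t [r e0 e2 bt]]] := IH (d :: acc) sc.
- by move=> y yxs; apply: Og; rewrite inE yxs orbT.
- by move=> y yxs; apply: Bg; rewrite inE yxs orbT.
- by rewrite /sc update_eq.
- by rewrite /sc /sb; update_tac.
exists s'; eexists; split.
- apply: RunWhileTrue; first by rewrite /= s1.
    apply: RunSeq; first by apply: (@RunQuery O _ _ _ d); rewrite /= s1.
    apply: RunSeq; first exact: RunAssign.
    exact: RunAssign.
  have -> : update s 3 d = sa by [].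
  have E : eval sa (ECons (EVar 3) (EVar 2)) = Cons d (code_seq acc).
    by rewrite /sa /=; update_tac; rewrite s2.
  rewrite E -/sb.
  have -> : eval sb (ETl (EVar 1)) = code_seq (map g xs).
    by rewrite /sb /sa /=; update_tac; rewrite s1.
  exact: r.
- by rewrite e0 /sc /sb /sa; update_tac.
- exact: e2.
- rewrite /= /sb /sa; update_tac; rewrite s1 s2 /=.
  move: bt => /=; set G := tree_size (code_seq (map g xs)).
  set X := tree_size (code_seq acc); set L := size xs.
  set K' := 2 * G + _ + _ + _ + _; set K := 2 * (_ + G).+1 + _ + _ + _ + _.
  (* The accumulator has gained one answer, but the list is one query shorter, which releases B + 1;
     so the bound per round does not increase. *)
  have KK : K' <= K by rewrite /K /K' mulSn; lia.
  have : L * K' <= L * K by rewrite leq_mul2l KK orbT.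
  by rewrite mulSn /K mulSn; lia.
Qed.

Definition conflict_code (H : listed_hypergraph) (i : nat) : tree :=
  tgraph (code_matrix (incidence_matrix H)) (code_nat #|lh H|) (code_nat i.+1).

Lemma tgraphs_code (H : listed_hypergraph) : tgraphs (code_hypergraph H) =
  code_seq (map (conflict_code H) (rev (iota 0 #|lh H|.+1))).
Proof.
rewrite /tgraphs code_hypergraphE [tree_hd _]/=.
rewrite -[Cons Nil (code_nat _)]/(code_nat #|lh H|.+1) tiota_code.
by rewrite (@tmap_map_code _ _ _ (conflict_code H)) // trev_code map_rev.
Qed.

(** An answer has one bit per node and the adjacency matrix one row per node, so answers are linear
    in the size of their queries. *)
Lemma mis_answer_size (H : listed_hypergraph) i d :
  mis_answer H i d -> tree_size d <= (4 * tree_size (conflict_code H i)).+1.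
Proof.
move=> [xs [S [_ Exs _ ->]]]; apply: leq_trans (tree_size_code_bits _) _.
rewrite ltnS leq_mul2l /= size_map /conflict_code -(code_graph_listing Exs).
apply: leq_trans (size_code_seq _).
by rewrite !size_map.
Qed.

(** By [node_listing] the tree built by the program codes an instance of [MIS_SEARCH], so the oracle
    has to answer it, with bits in the listing known to the program. *)
Lemma oracle_mis_answer O (H : listed_hypergraph) i :
  oracle_solves O MIS_SEARCH ->
  O (conflict_code H i) = Some (answer O (conflict_code H i)) /\
  mis_answer H i (answer O (conflict_code H i)).
Proof.
have [xs pxs Exs] := node_listing H i.+1.
move=> /(_ (ListedConflictGraph (ltn0Sn i) pxs))[d].
rewrite /= /code_conflict_graph /= (code_graph_listing Exs) /answer.
move=> -> [S mS Ed].
by split=> //; exists xs, S.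
Qed.

Lemma cf_turing_mis : turing_reducible CF_SEARCH MIS_SEARCH.
Proof.
have [c1 [N1 [T1 [pT1 H1]]]] : polyfun (fun z => Cons z (tgraphs z)).
  by apply: polyfun_cons; [|apply: polyfun_tgraphs]; polyfun_tac.
have [c2 [N2 [T2 [pT2 H2]]]] :
    polyfun (fun z => tsolution (tree_hd z) (tree_tl z)).
  by apply: polyfun_tsolution; polyfun_tac.
(* For inputs of size n, [B] bounds one answer, [A] the list of all answers and [loop] the time of
   the query phase; [T1] bounds both the number and the total size of the queries. *)
pose B n := (4 * T1 n).+1.
pose A n := (T1 n * (B n).+1).+1.
pose loop n := (T1 n * (2 * T1 n + 2 * B n + 1 + T1 n * (B n).+1 + 5)).+1.
pose T n := T1 n + ((T1 n).+1 + (n.+1 + (2 + (loop n +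
  ((n + A n).+2 + T2 (n + A n).+1))))).
have pB : poly_bound B by rewrite /B; poly_bound_tac.
have pA : poly_bound A by rewrite /A; poly_bound_tac.
have pT : poly_bound T by rewrite /T /loop; poly_bound_tac.
have [p Tp] := poly_bound_poly pT.
exists (Seq c1 (Seq (Assign 1 (ETl (EVar 0))) (Seq (Assign 0 (EHd (EVar 0)))
  (Seq (Assign 2 ENil) (Seq query_loop
    (Seq (Assign 0 (ECons (EVar 0) (EVar 2))) c2)))))), p => O solO H.
have [h hE] : exists h, h = code_hypergraph H by exists (code_hypergraph H).
pose ks := rev (iota 0 #|lh H|.+1).
have [W WE] : exists W, W = tree_size h by exists (tree_size h).
rewrite -[scode _]/(code_hypergraph H) -hE -WE.
pose s0 := update (fun=> Nil) 0 h.
have [s1 [t1 [r1 e1 _ b1 z1]]] := H1 O s0.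
have s00 : s0 0 = h by apply: update_eq.
rewrite s00 -?WE in e1 b1 z1.
set gs := tgraphs h in e1 z1.
have gsE : gs = code_seq (map (conflict_code H) ks).
  by rewrite /gs hE; apply: tgraphs_code.
have gsW : tree_size gs <= T1 W by move: z1 => /=; lia.
have ksW : size ks <= T1 W.
  apply: leq_trans gsW; rewrite gsE -(size_map (conflict_code H) ks).
  exact: size_code_seq.
have ansB : {in ks, forall i, tree_size (answer O (conflict_code H i)) <= B W}.
  move=> i ik; have [_ /mis_answer_size] := oracle_mis_answer H i solO.
  move=> le_ans; apply: leq_trans le_ans _.
  rewrite ltnS leq_mul2l /=; apply: leq_trans gsW; rewrite gsE.
  exact: tree_size_code_seq_mem.
set s2 := update s1 1 gs; set s3 := update s2 0 h; set s4 := update s3 2 Nil.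
have [|||s5 [t5 [r5 e50 e52 b5]]] :=
  @run_query_loop O _ (conflict_code H) (B W) ks [::] s4 _ ansB.
- by move=> i _; case: (oracle_mis_answer H i solO).
- by rewrite /s4 /s3 /s2; update_tac.
- by rewrite /s4 update_eq.
set ans := code_seq _ in e52.
have ansW : tree_size ans <= A W.
  rewrite /ans -/(rev _) -map_rev; apply: leq_trans (tree_size_code_map _) _.
    by move=> i; rewrite mem_rev; apply: ansB.
  by rewrite size_rev /A ltnS leq_mul2r ksW orbT.
set s6 := update s5 0 (Cons h ans).
have [s7 [t7 [r7 e7 _ b7 _]]] := H2 O s6.
have s60 : s6 0 = Cons h ans by apply: update_eq.
rewrite s60 in e7 b7.
have s40 : s4 0 = h by rewrite /s4 /s3; update_tac.
exists (s7 0); eexists; split.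
- exists s7 => //.
  apply: RunSeq; first exact: r1.
  apply: RunSeq; first exact: RunAssign.
  have -> : eval s1 (ETl (EVar 0)) = gs by rewrite /= e1.
  have E : eval s2 (EHd (EVar 0)) = h.
    by rewrite /s2 /=; update_tac; rewrite e1.
  apply: RunSeq; first exact: RunAssign.
  rewrite -/s2 E; apply: RunSeq; first exact: RunAssign.
  apply: RunSeq; first exact: r5.
  apply: RunSeq; first exact: RunAssign.
  by rewrite /= e50 e52 s40; exact: r7.
- apply: leq_trans (Tp W); rewrite /= e50 e52 s40 update_neq // e1 /=.
  have := proj1 pT2 (tree_size (Cons h ans)) (W + A W).+1.
  rewrite /= -WE ltnS leq_add2l => /(_ ansW) le2.
  have loopW : t5 <= loop W.
    apply: leq_trans b5 _; rewrite ltnS -gsE /=; apply: leq_mul => //.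
    have : size ks * (B W).+1 <= T1 W * (B W).+1 by rewrite leq_mul2r ksW orbT.
    by lia.
  by move: b7; rewrite /= -WE /T; lia.
(* The two reversals cancel, so the answers are in increasing order of the number of colours. *)
- rewrite e7 hE /= /ans -/(rev _) -map_rev revK.
  apply: tsolution_correct => i _.
  by case: (oracle_mis_answer H i solO).
Qed.

Theorem theorem3 :
  (forall (H : hypergraph) (k : nat), is_kmin H k <-> chi_cf H = k) /\
  polytime code_colouring_instance
    (fun I d => represents_graph (conflict_graph I (ci_k I)) d) /\
  karp_reducible CF_DECISION MIS_DECISION /\
  turing_reducible CF_SEARCH MIS_SEARCH.
Proof.
split; first exact: is_kmin_chi_cf.
split; first exact: conflict_graph_polytime.
by split; [exact: cf_karp_mis | exact: cf_turing_mis].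
Qed.
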